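(* Let $(M,Q,\omega)$ be an almost quaternionic skew-Hermitian manifold of dimension $4n$, $n>1$, with canonical connection $\nabla^{Q,\omega}$. Then $Q$ is quaternionic (i.e. $TM$ admits a torsion-free connection preserving $Q$) if and only if $(Q,\omega)$ is of type $\mathcal{X}_{345}$, that is, the components of the torsion of $\nabla^{Q,\omega}$ in $\mathcal{X}_1=[\mathsf{K}S^3\mathsf{H}]^*$ and $\mathcal{X}_2=[\Lambda^3\mathsf{E}\,S^3\mathsf{H}]^*$ vanish.
   Context: $M$ is a connected smooth $4n$-manifold, $n>1$. An almost quaternionic structure $Q\subset \mathrm{End}(TM)$ is a rank 3 subbundle locally spanned by triples $\{J_1,J_2,J_3\}$ (admissible bases) of almost complex structures with $J_1J_2=-J_2J_1=J_3$. A scalar 2-form is a non-degenerate 2-form $\omega$ with $\omega(J_aX,J_aY)=\omega(X,Y)$ for all $a$ and all admissible bases; then $(Q,\omega)$ is an almost quaternionic skew-Hermitian structure (equivalently an $\mathsf{SO}^*(2n)\mathsf{Sp}(1)$-structure). Modules: $\mathsf{E}=\mathbb{C}^{2n}$, $\mathsf{H}=\mathbb{C}^2$ are the standard representations of $\mathsf{SO}^*(2n)$, $\mathsf{Sp}(1)$; $[\,\cdot\,]$ denotes the real form; $T_xM\cong[\mathsf{E}\mathsf{H}]$. $\mathsf{E}$ carries an invariant complex symmetric form; $S^k_0\mathsf{E}$ denotes trace-free symmetric tensors. $\mathsf{E}\otimes\Lambda^2\mathsf{E}=\Lambda^3\mathsf{E}\oplus\mathsf{K}\oplus\mathsf{E}$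 (totally skew part; kernel $\mathsf{K}$ of total antisymmetrization and trace; pure trace part), and similarly $\mathsf{E}\otimes S^2_0\mathsf{E}\cong S^3_0\mathsf{E}\oplus\mathsf{K}\oplus\mathsf{E}$. In the torsion space $\Lambda^2[\mathsf{EH}]^*\otimes[\mathsf{EH}]$ the $S^3\mathsf{H}$-isotypic part for $\mathsf{Sp}(1)$ is $[(\mathsf{E}\otimes\Lambda^2\mathsf{E})S^3\mathsf{H}]^*=[\mathsf{K}S^3\mathsf{H}]^*\oplus[\Lambda^3\mathsf{E}S^3\mathsf{H}]^*\oplus[\mathsf{E}S^3\mathsf{H}]^*$; the first two summands are $\mathcal{X}_1,\mathcal{X}_2$. Identify $[S^2_0\mathsf{E}]^*$ with the trace-free endomorphisms $B$ commuting with $Q$ for which $\omega(B\cdot,\cdot)$ is skew. With $\delta(A)(X,Y)=A(X,Y)-A(Y,X)$, the images under $\delta$ of the components $[\mathsf{KH}]^*,[\mathsf{EH}]^*,[S^3_0\mathsf{E}\mathsf{H}]^*$ of $[\mathsf{EH}]^*\otimes[S^2_0\mathsf{E}]^*$ are $\mathcal{X}_3,\mathcal{X}_4,\mathcal{X}_5$. Write $\mathcal{X}_{i_1\ldots i_j}=\mathcal{X}_{i_1}\oplus\cdots\oplus\mathcal{X}_{i_j}$. Connections: an Oproiu connection is a connection preserving $Q$ whose torsion $T^Q$ (the same for all of them) lies in $\mathcal{X}_{12}$. $\nabla^{Q,\mathrm{vol}}$ is the unique Oproiu connection preserving $\mathrm{vol}=\omega^{2n}$. The canonical connection is $\nabla^{Q,\omega}=\nabla^{Q,\mathrm{vol}}+A^{\mathrm{vol}}$,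 where $\omega(A^{\mathrm{vol}}(X,Y),Z)=\frac12(\nabla^{Q,\mathrm{vol}}_X\omega)(Y,Z)$; it preserves $Q$ and $\omega$, and its torsion takes values in $\mathcal{X}_{12345}$. $(Q,\omega)$ is of type $\mathcal{X}_{i_1\ldots i_j}$ if the torsion of $\nabla^{Q,\omega}$ takes values in $\mathcal{X}_{i_1\ldots i_j}$. *)

(* Defs.v *)
From HB Require Import structures.
From mathcomp Require Import all_boot all_order all_algebra all_fingroup.
From mathcomp Require Import complex.
From mathcomp Require Import all_classical all_reals all_analysis.

Set Implicit Arguments.
Unset Strict Implicit.
Unset Printing Implicit Defensive.

Import Order.TTheory GRing.Theory Num.Theory.
Import numFieldNormedType.Exports.

Local Open Scope classical_set_scope.
Local Open Scope ring_scope.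


(** * Smooth maps between finite-dimensional spaces *)

(* The domain U is meant to be open; in finite dimension, p |-> 'd f p is of
   class C^k iff all the p |-> 'd f p v are. *)
Fixpoint Ck {R : realType} {V W : normedModType R} (k : nat) (U : set V)
    (f : V -> W) : Prop :=
  match k with
  | 0 => forall p, U p -> {for p, continuous f}
  | k'.+1 => (forall p, U p -> differentiable f p) /\
             (forall v, Ck k' U (fun p => 'd f p v))
  end.

Definition smooth_on {R : realType} {V W : normedModType R} (U : set V)
  (f : V -> W) : Prop := forall k, Ck k U f.

(** * Smooth manifolds *)

Record chart (R : realType) (m : nat) (M : topologicalType) := Chart {
  cdom : set M;
  cfwd : M -> 'cV[R]_m;
  cbwd : 'cV[R]_m -> M }.

Definition chart_ok (R : realType) (m : nat) (M : topologicalType)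
    (c : chart R m M) : Prop :=
  [/\ open (cdom c),
      open (cfwd c @` cdom c),
      (forall x, cdom c x -> cbwd c (cfwd c x) = x),
      (forall x, cdom c x -> {for x, continuous (cfwd c)}) &
      (forall p, (cfwd c @` cdom c) p -> {for p, continuous (cbwd c)})].

(* A preferred chart at every point is part of the data, and T_xM is
   represented by the coordinates of tangent vectors in that chart: it is the
   type 'cV[R]_m for every x.  Smoothness of fields is nevertheless always
   tested in all the charts of the atlas, after the change of coordinates
   [push] below, since [chart_at] may vary wildly from point to point. *)
Record smoothManifold (R : realType) (m : nat) := SmoothManifold {
  carrier :> topologicalType;
  atlas : set (chart R m carrier);
  chart_at : carrier -> chart R m carrier;
  manifold_hausdorff : hausdorff_space carrier;
  manifold_second_countable : @second_countable carrier;
  atlas_ok : forall c, atlas c -> chart_ok c;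
  atlas_compatible : forall c d, atlas c -> atlas d ->
    smooth_on (cfwd c @` (cdom c `&` cdom d)) (cfwd d \o cbwd c);
  chart_at_atlas : forall x, atlas (chart_at x);
  chart_at_dom : forall x, cdom (chart_at x) x }.

Section Manifold.
Context {R : realType} {m : nat} {M : smoothManifold R m}.

Local Notation TV := 'cV[R]_m.
Local Notation End := 'M[R]_m.

Definition coord (x : M) : TV := cfwd (chart_at x) x.

(* Coordinates in the chart c of the tangent vector v at x. *)
Definition push (c : chart R m M) (x : M) (v : TV) : TV :=
  'd (cfwd c \o cbwd (chart_at x)) (coord x) v.

Definition vfield := M -> TV.

Definition vrep (c : chart R m M) (X : vfield) : TV -> TV :=
  fun p => push c (cbwd c p) (X (cbwd c p)).

Definition smooth_vf (U : set M) (X : vfield) : Prop :=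
  forall c, atlas c -> smooth_on (cfwd c @` (U `&` cdom c)) (vrep c X).

Definition smooth_fun (U : set M) (f : M -> R) : Prop :=
  forall c, atlas c ->
    smooth_on (cfwd c @` (U `&` cdom c)) (f \o cbwd c : TV -> R^o).

Definition smooth_vf_near (x : M) (X : vfield) : Prop :=
  exists U, [/\ open U, U x & smooth_vf U X].

Definition smooth_fun_near (x : M) (f : M -> R) : Prop :=
  exists U, [/\ open U, U x & smooth_fun U f].

Definition dir (x : M) (v : TV) (f : M -> R) : R :=
  'd (f \o cbwd (chart_at x) : TV -> R^o) (coord x) v.

(* The Lie bracket, computed in the preferred chart at x. *)
Definition bracket (X Y : vfield) : vfield := fun x =>
  'd (vrep (chart_at x) Y) (coord x) (X x)
  - 'd (vrep (chart_at x) X) (coord x) (Y x).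

(* J z is an endomorphism of T_zM, acting on column vectors, so that the
   composition of endomorphisms is the matrix product. *)
Definition smooth_endo (U : set M) (J : M -> End) : Prop :=
  forall (V : set M) (X : vfield), open V -> V `<=` U ->
    smooth_vf V X -> smooth_vf V (fun z => J z *m X z).

Definition form (b : End) (v w : TV) : R := (v^T *m b *m w) 0 0.

Definition smooth_form (b : M -> End) : Prop :=
  forall (V : set M) (X Y : vfield), open V ->
    smooth_vf V X -> smooth_vf V Y ->
    smooth_fun V (fun z => form (b z) (X z) (Y z)).

(** * Affine connections *)

(* [D x v Y] is the covariant derivative at x of the local section Y in the
   direction v.  The values on fields that are not smooth near x are
   irrelevant. *)
Definition covder := M -> TV -> vfield -> TV.

Definition is_connection (D : covder) : Prop :=
  (forall x a v w Y, smooth_vf_near x Y ->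
     D x (a *: v + w) Y = a *: D x v Y + D x w Y) /\
  (forall x v Y Z, smooth_vf_near x Y -> smooth_vf_near x Z ->
     D x v (fun z => Y z + Z z) = D x v Y + D x v Z) /\
  (forall x v f Y, smooth_fun_near x f -> smooth_vf_near x Y ->
     D x v (fun z => f z *: Y z) = dir x v f *: Y x + f x *: D x v Y) /\
  (forall x v (U : set M) Y Z, open U -> U x ->
     smooth_vf U Y -> smooth_vf U Z -> (forall z, U z -> Y z = Z z) ->
     D x v Y = D x v Z) /\
  (forall (U : set M) X Y, open U -> smooth_vf U X -> smooth_vf U Y ->
     smooth_vf U (fun z => D z (X z) Y)).

Definition torsion (D : covder) (X Y : vfield) : vfield := fun x =>
  D x (X x) Y - D x (Y x) X - bracket X Y x.

(* T is the value at x of the torsion tensor. *)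
Definition is_torsion_at (D : covder) (x : M) (T : TV -> TV -> TV) : Prop :=
  forall X Y, smooth_vf_near x X -> smooth_vf_near x Y ->
    torsion D X Y x = T (X x) (Y x).

Definition torsion_free (D : covder) : Prop :=
  forall x, is_torsion_at D x (fun _ _ => 0).

(* B is the covariant derivative at x, along v, of the endomorphism field J. *)
Definition is_nabla_endo (D : covder) (x : M) (v : TV) (J : M -> End)
    (B : End) : Prop :=
  forall Y, smooth_vf_near x Y ->
    D x v (fun z => J z *m Y z) - J x *m D x v Y = B *m Y x.

Definition nabla_form (D : covder) (b : M -> End) (x : M) (v : TV)
    (Y Z : vfield) : R :=
  dir x v (fun z => form (b z) (Y z) (Z z))
  - form (b x) (D x v Y) (Z x) - form (b x) (Y x) (D x v Z).

(* The m-form given by the wedge power of exponent m./2 of the 2-form b, for m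
   even:
   b^k (v_0, .., v_(2k-1)) = 2^-k sum_s sgn(s) prod_(i < k) b(v_s(2i), v_s(2i+1)). *)
Definition form_top (b : End) (v : 'I_m -> TV) : R :=
  (2 ^+ m./2)^-1 * \sum_(s : 'S_m) (-1) ^+ s *
    \prod_(ij : 'I_m * 'I_m | ~~ odd ij.1 && (ij.2 == ij.1.+1 :> nat))
      form b (v (s ij.1)) (v (s ij.2)).

Definition preserves_vol (D : covder) (b : M -> End) : Prop :=
  forall x v (Y : 'I_m -> vfield), (forall i, smooth_vf_near x (Y i)) ->
    dir x v (fun z => form_top (b z) (fun i => Y i z)) =
    \sum_(i < m) form_top (b x) (fun j => if j == i then D x v (Y i) else Y j x).

(** * Almost quaternionic and quaternionic structures *)

Definition admissible (Q : M -> set End) (U : set M) (J1 J2 J3 : M -> End) :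
    Prop :=
  [/\ smooth_endo U J1, smooth_endo U J2, smooth_endo U J3 &
      forall x, U x ->
        [/\ J1 x *m J1 x = - 1%:M, J2 x *m J2 x = - 1%:M,
            J3 x *m J3 x = - 1%:M,
            J1 x *m J2 x = J3 x /\ J2 x *m J1 x = - J3 x &
            Q x = [set B | exists a1 a2 a3 : R,
                     B = a1 *: J1 x + a2 *: J2 x + a3 *: J3 x]]].

Definition almost_quaternionic (Q : M -> set End) : Prop :=
  forall x, exists (U : set M) (J1 J2 J3 : M -> End),
    [/\ open U, U x & admissible Q U J1 J2 J3].

Definition preserves_Q (Q : M -> set End) (D : covder) : Prop :=
  forall x v (U : set M) (J : M -> End), open U -> U x -> smooth_endo U J ->
    (forall z, U z -> Q z (J z)) ->
    exists2 B, Q x B & is_nabla_endo D x v J B.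

Definition quaternionic (Q : M -> set End) : Prop :=
  exists D, [/\ is_connection D, preserves_Q Q D & torsion_free D].

Definition scalar_form (Q : M -> set End) (omega : M -> End) : Prop :=
  [/\ smooth_form omega,
      (forall x, (omega x)^T = - omega x),
      (forall x, omega x \in unitmx) &
      forall (U : set M) J1 J2 J3, open U -> admissible Q U J1 J2 J3 ->
        forall x v w, U x ->
          [/\ form (omega x) (J1 x *m v) (J1 x *m w) = form (omega x) v w,
              form (omega x) (J2 x *m v) (J2 x *m w) = form (omega x) v w &
              form (omega x) (J3 x *m v) (J3 x *m w) = form (omega x) v w]].

Definition almost_quaternionic_skew_hermitian (Q : M -> set End)
    (omega : M -> End) : Prop :=
  almost_quaternionic Q /\ scalar_form Q omega.

End Manifold.

Arguments covder {R m} M.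

(** * The SO*(2n)Sp(1)-module [EH] *)

Section Model.
Context {R : realType} {n : nat}.
Local Open Scope complex_scope.

Local Notation C := R[i].
Local Notation N := (n + n)%N.

(* E = C^N with symmetric form g(e, e') = e^T e' and quaternionic structure
   e |-> jE (conj e); H = C^2 with skew form s(h, h') = h^T sH h' and
   quaternionic structure h |-> sH (conj h).  SO*(2n) is the group of complex
   orthogonal matrices commuting with the first quaternionic structure, and
   Sp(1) = SU(2).  E (x) H is the space of N x 2 matrices, e (x) h being
   e h^T. *)
Definition jE : 'M[C]_N := block_mx 0 1%:M (- 1%:M) 0.

Definition sH : 'M[C]_2 :=
  \matrix_(h, k) ((k == h.+1 :> nat)%:R - (h == k.+1 :> nat)%:R).

Definition real_form : set 'M[C]_(N, 2) :=
  [set Z | jE *m map_mx conjc Z *m sH^T = Z].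

Definition gs (Z W : 'M[C]_(N, 2)) : C :=
  \sum_a \sum_h \sum_k Z a h * sH h k * W a k.

Definition su2 : set 'M[C]_2 :=
  [set q | (map_mx conjc q)^T = - q /\ \tr q = 0].

Definition etensor := 'I_N -> 'I_N -> 'I_N -> C.

(* Lambda^3 E and K inside Lambda^2 E (x) E *)
Definition skew12 (f : etensor) : Prop := forall a b c, f a b c = - f b a c.

Definition in_L3 (f : etensor) : Prop :=
  skew12 f /\ (forall a b c, f a b c = - f a c b).

Definition in_Kalt (f : etensor) : Prop :=
  [/\ skew12 f,
      (forall a b c, f a b c + f b c a + f c a b = 0) &
      forall b, \sum_a f a b a = 0].

(* S^3_0 E, K and E inside E (x) S^2_0 E *)
Definition sym23_tracefree (f : etensor) : Prop :=
  (forall a b c, f a b c = f a c b) /\ (forall a, \sum_b f a b b = 0).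

Definition in_S30 (f : etensor) : Prop :=
  sym23_tracefree f /\ (forall a b c, f a b c = f b a c).

Definition in_Ksym (f : etensor) : Prop :=
  [/\ sym23_tracefree f,
      (forall a b c, f a b c + f b c a + f c a b = 0) &
      forall c, \sum_a f a a c = 0].

Definition in_Esym (f : etensor) : Prop :=
  exists e : 'I_N -> C, forall a b c,
    f a b c = (a == b)%:R * e c + (a == c)%:R * e b
              - (n%:R)^-1 * (b == c)%:R * e a.

Definition htensor := 'I_2 -> 'I_2 -> 'I_2 -> C.

Definition in_S3H (s : htensor) : Prop :=
  forall h k l, s h k l = s k h l /\ s h k l = s h l k.

Definition ehtensor :=
  'I_N -> 'I_N -> 'I_N -> 'I_2 -> 'I_2 -> 'I_2 -> C.

Definition eheval (F : ehtensor) (Z1 Z2 Z3 : 'M[C]_(N, 2)) : C :=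
  \sum_a \sum_b \sum_c \sum_h \sum_k \sum_l
    F a b c h k l * Z1 a h * Z2 b k * Z3 c l.

(* P (x) S^3H, for a subspace P of E (x) E (x) E *)
Definition tensor_S3H (P : etensor -> Prop) (F : ehtensor) : Prop :=
  (forall h k l, P (fun a b c => F a b c h k l)) /\
  (forall a b c, in_S3H (F a b c)).

(* P (x) H, embedded with H in the first slot and the form s in the last two *)
Definition tensor_H (P : etensor -> Prop) (F : ehtensor) : Prop :=
  exists f : 'I_2 -> etensor,
    (forall h, P (f h)) /\
    (forall a b c h k l, F a b c h k l = f h a b c * sH k l).

Local Notation TV := 'cV[R]_(4 * n).
Local Notation End := 'M[R]_(4 * n).

(* An isomorphism of a tangent space with [EH], carrying Q to sp(1) and omega
   to g (x) s. *)
Definition adapted (Q : set End) (omega : End) (theta : TV -> 'M[C]_(N, 2)) :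
    Prop :=
  [/\ (forall a v w, theta (a *: v + w) = a%:C *: theta v + theta w),
      injective theta /\ range theta = real_form,
      (forall B, Q B <-> exists2 q, su2 q &
                           forall v, theta (B *m v) = theta v *m q^T) &
      (forall v w, (form omega v w)%:C = gs (theta v) (theta w))].

Definition bitensor := TV -> TV -> TV.

(* F is the complexification of omega(T(u, v), w).  Lowering the last index
   with omega identifies T*(x)T*(x)T with T*(x)T*(x)T*. *)
Definition lowers_to (omega : End) (theta : TV -> 'M[C]_(N, 2))
    (T : bitensor) (F : ehtensor) : Prop :=
  forall u v w,
    (form omega (T u v) w)%:C = eheval F (theta u) (theta v) (theta w).

(* Real elements of P S^3H, for P inside Lambda^2 E (x) E: the S^3H-isotypic
   part of Lambda^2(EH) (x) EH lies in Lambda^2E S^2H (x) EH, where it is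
   (Lambda^2E (x) E) S^3H. *)
Definition torsion_S3H (P : etensor -> Prop) omega theta (T : bitensor) :
    Prop :=
  exists2 F, tensor_S3H P F & lowers_to omega theta T F.

Definition delta (A : bitensor) : bitensor := fun u v => A u v - A v u.

(* A tensor F in E (x) S^2_0E (x) H is the lowered form of an A such that each
   A(u, -) commutes with Q (s in the last two slots), has omega(A(u, -), -)
   skew (symmetry in the last two E-slots) and is trace-free. *)
Definition delta_H (P : etensor -> Prop) omega theta (T : bitensor) : Prop :=
  exists (A : bitensor) (F : ehtensor),
    [/\ tensor_H P F, lowers_to omega theta A F & T = delta A].

Definition X_ (i : nat) : End -> (TV -> 'M[C]_(N, 2)) -> bitensor -> Prop :=
  match i with
  | 1 => torsion_S3H in_Kalt
  | 2 => torsion_S3H in_L3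
  | 3 => delta_H in_Ksym
  | 4 => delta_H in_Esym
  | 5 => delta_H in_S30
  | _ => fun _ _ T => T = fun _ _ => 0
  end.

Definition X_sum (I : seq nat) omega theta (T : bitensor) : Prop :=
  exists Ti : nat -> bitensor,
    (forall i, i \in I -> X_ i omega theta (Ti i)) /\
    (forall u v, T u v = \sum_(i <- I) Ti i u v).

End Model.

(** * Types of almost quaternionic skew-Hermitian structures *)

Section Types.
Context {R : realType} {n : nat} {M : smoothManifold R (4 * n)}.
Variables (Q : M -> set 'M[R]_(4 * n)) (omega : M -> 'M[R]_(4 * n)).

(* The modules X_ i are SO*(2n)Sp(1)-invariant, so the choice of theta does
   not matter. *)
Definition torsion_in (I : seq nat) (D : covder M) : Prop :=
  forall x, exists theta T,
    [/\ adapted (Q x) (omega x) theta, is_torsion_at D x T &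
        X_sum I (omega x) theta T].

Definition oproiu (D : covder M) : Prop :=
  [/\ is_connection D, preserves_Q Q D & torsion_in [:: 1; 2]%N D].

Definition oproiu_vol (D : covder M) : Prop :=
  oproiu D /\ preserves_vol D omega.

Definition canonical_connection (D : covder M) : Prop :=
  exists (D0 : covder M) (A : M -> @bitensor R n),
    [/\ oproiu_vol D0,
        (forall x v Y Z, smooth_vf_near x Y -> smooth_vf_near x Z ->
           form (omega x) (A x v (Y x)) (Z x)
           = 2^-1 * nabla_form D0 omega x v Y Z) &
        (forall x v Y, smooth_vf_near x Y -> D x v Y = D0 x v Y + A x v (Y x))].

End Types.

(* Main.v *)
Require Import Defs.
From HB Require Import structures.
From mathcomp Require Import all_boot all_order all_algebra all_fingroup.
From mathcomp Require Import complex ring lra zify.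
From mathcomp Require Import all_classical all_reals all_analysis.
(* Again, because mathcomp also has a [form]. *)
Require Import Defs.

(** The structure group of [Q] has Lie algebra gl(n,H) + sp(1), and the torsions
    of two connections preserving [Q] differ by [delta B], where each [B v]
    normalizes [Q].  Such a [delta B] meets X_1 + X_2 in 0: in the S^3H-isotypic
    part only the sp(1)-component of [B] contributes, and it contributes a pure
    trace in Lambda^2 E (x) E, whereas X_1 and X_2 are trace-free.  So the torsion
    T^Q of the Oproiu connection vanishes as soon as [Q] admits a torsion-free
    connection, or as soon as T^Q is [delta B] for a [B] with values in gl(n,H).

    The difference [A] between the canonical and the Oproiu connection commutes
    with [Q], is skew for [omega], and is trace-free because the Oproiu connection
    preserves the volume form.  Hence it is a section of [EH]* (x) [S^2_0 E]*, and
    [delta A] is in X_345.  The torsion of the canonical connection is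
    T^Q + [delta A]; so it lies in X_345 iff T^Q = 0. *)

(** Vectors at x extend to chart-constant fields, so identities between connections become
    identities of tensors on one tangent space, where they are checked in components on E (x) H. In
    components, the gl(n,H)-part of [B v] is skew in its two H-slots, while the sp(1)-part is
    symmetric there and a Kronecker delta in the two E-slots. Symmetrizing over three H-slots
    removes the first and leaves only deltas of the second, hence the pure trace.

    The real tangent space spans E (x) H over the complex numbers, so vanishing can be tested on
    real vectors. The other passage has a cost: the K-, E- and S^3_0 E-components of a real tensor
    have to be shown real before they come from bitensors on the tangent space.

    The volume form is a sum over permutations. Its derivative is computed over polynomials from the
    congruence rule pf (W^T O W) = pf O det W, and the trace of [A] is isolated by cancelling the
    Pfaffian sum of [omega]. An adapted isomorphism brings [omega] to the standard symplectic
    matrix, and this shows that the sum is nonzero. *)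

Set Implicit Arguments.
Unset Strict Implicit.
Unset Printing Implicit Defensive.

Import Order.TTheory GRing.Theory Num.Theory.
Import numFieldNormedType.Exports.

Local Open Scope classical_set_scope.
Local Open Scope ring_scope.

(** * Calculus of C^k maps *)

Section NearEq.
Context {R : realType} {V W : normedModType R}.
Implicit Types (f g : V -> W) (p : V).

Lemma near_eq_differentiable f g p : {near p, f =1 g} ->
  differentiable f p -> differentiable g p.
Proof.
move=> fg df; have /diff_locallyP [dfc dfE] := df.
have fgp : f p = g p by exact: nbhs_singleton fg.
suff gE : g \o shift p = cst (g p) + 'd f p +o_ 0 id.
  by apply/diff_locallyP; rewrite (diff_unique dfc gE).
apply/eqaddoP => _/posnumP[e]; move/eqaddoP: dfE => /(_ e%:num (gt0 e)).
apply: filter_app; move: fg; rewrite (near_shift 0)/= subr0.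
by apply: filterS => h /= fgh; rewrite !fctE /= /cst -fgh -fgp.
Qed.

Lemma near_eq_diff f g p v : {near p, f =1 g} ->
  differentiable f p -> 'd f p v = 'd g p v.
Proof.
move=> fg df; rewrite -!deriveE//; last exact: near_eq_differentiable df.
exact: near_eq_derive.
Qed.

Lemma diff_scale (a : V -> R^o) g p : differentiable a p -> differentiable g p ->
  differentiable (fun q => a q *: g q) p /\
  forall v, 'd (fun q => a q *: g q) p v = 'd a p v *: g p + a p *: 'd g p v.
Proof.
move=> da dg.
(* Scaling is packaged as a bilinear map, so that the product rule is the differential of a bilinear
   map composed with a pair. *)
have bil : bilinear_for (GRing.Scale.Law.clone _ _ *:%R _)
    (GRing.Scale.Law.clone _ _ *:%R _) (fun (c : R^o) (w : W) => c *: w).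
  split=> [u'|u] c x y /=; first by rewrite scalerDl scalerA.
  by rewrite scalerDr !scalerA mulrC.
pose B := bilinear_isBilinear.Build R R^o W W _ _ _ bil.
pose b : {bilinear R^o -> W -> W} := HB.pack (fun (c : R^o) (w : W) => c *: w) B.
have bc : continuous (fun z : R^o * W => b z.1 z.2) by exact: scale_continuous.
have -> : (fun q => a q *: g q) = (fun z => b z.1 z.2) \o (fun q => (a q, g q)).
  by [].
have dp := differentiable_pair da dg.
have db := differentiable_bilin (a p, g p) bc.
split; first exact: differentiable_comp.
by move=> v; rewrite diff_comp// diff_bilin//= diff_pair//= addrC.
Qed.

End NearEq.

Section CkCalculus.
Context {R : realType}.

Lemma Ck_sub (V W : normedModType R) k (U U' : set V) (f : V -> W) :
  U' `<=` U -> Ck k U f -> Ck k U' f.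
Proof.
move=> sU; elim: k f => [|k IH] f /=; first by move=> H p /sU; exact: H.
by move=> [df H]; split=> [p /sU|v]; [exact: df|exact/IH/H].
Qed.

Lemma Ck_pred (V W : normedModType R) k (U : set V) (f : V -> W) :
  Ck k.+1 U f -> Ck k U f.
Proof.
elim: k f => [|k IH] f; first by move=> [df _] p /df /differentiable_continuous.
by move=> [df H]; split=> // v; exact/IH/H.
Qed.

Lemma Ck_ext (V W : normedModType R) k (U : set V) (f g : V -> W) :
  open U -> (forall p, U p -> f p = g p) -> Ck k U f -> Ck k U g.
Proof.
move=> oU; elim: k f g => [|k IH] f g fg.
  move=> cf p Up; have fgp : {near p, f =1 g}.
    by near=> q; apply: fg; near: q; exact: open_nbhs_nbhs.
  have cfp : f @ p --> f p by exact: cf.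
  change (g @ p --> g p); rewrite -(fg p Up).
  by apply: cvg_trans cfp; exact: near_eq_cvg.
move=> [df H]; have near_fg p : U p -> {near p, f =1 g}.
  by move=> Up; near=> q; apply: fg; near: q; exact: open_nbhs_nbhs.
split=> [p Up|v]; first exact: near_eq_differentiable (near_fg _ Up) (df _ Up).
by apply: IH (H v) => p Up; apply: near_eq_diff (near_fg _ Up) (df _ Up).
Unshelve. all: by end_near. Qed.

Lemma Ck_cst (V W : normedModType R) k (U : set V) (w : W) :
  Ck k U (fun _ : V => w).
Proof.
elim: k w => [|k IH] w; first by move=> p _; exact: cst_continuous.
split=> [p _|v]; first exact: differentiable_cst.
by rewrite (_ : (fun _ => _) = (fun=> 0))//; apply/funext => p; rewrite diff_cst.
Qed.

Lemma Ck_add (V W : normedModType R) k (U : set V) (f g : V -> W) :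
  open U -> Ck k U f -> Ck k U g -> Ck k U (fun p => f p + g p).
Proof.
move=> oU; elim: k f g => [|k IH] f g.
  by move=> cf cg p Up; apply: continuousD; [exact: cf|exact: cg].
move=> [df Hf] [dg Hg]; split=> [p Up|v].
  by apply: differentiableD; [exact: df|exact: dg].
apply: Ck_ext (IH _ _ (Hf v) (Hg v)) => // p Up.
exact/esym/(congr1 (@^~ v) (diffD (df _ Up) (dg _ Up))).
Qed.

Lemma Ck_scale (V W : normedModType R) k (U : set V) (a : V -> R^o) (g : V -> W) :
  open U -> Ck k U a -> Ck k U g -> Ck k U (fun p => a p *: g p).
Proof.
move=> oU; elim: k a g => [|k IH] a g.
  move=> ca cg p Up; apply: continuousZ; [exact: ca|exact: cg].
move=> Ca Cg; have [[da Ha] [dg Hg]] := (Ca, Cg); split=> [p Up|v].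
  exact: (diff_scale (da _ Up) (dg _ Up)).1.
(* Each term of the product rule keeps one factor undifferentiated; [Ck_pred] lowers its class to
   k. *)
have := Ck_add oU (IH _ _ (Ha v) (Ck_pred Cg)) (IH _ _ (Ck_pred Ca) (Hg v)).
by apply: Ck_ext => // p Up; rewrite (diff_scale (da _ Up) (dg _ Up)).2.
Qed.

Lemma Ck_sum (V W : normedModType R) k (U : set V) n (f : 'I_n -> V -> W) :
  open U -> (forall i, Ck k U (f i)) -> Ck k U (fun p => \sum_i f i p).
Proof.
move=> oU; elim: n f => [|n IH] f Cf.
  rewrite (_ : (fun _ => _) = (fun=> 0)); first exact: Ck_cst.
  by apply/funext => p; rewrite big_ord0.
rewrite (_ : (fun _ => _) = (fun p => f ord0 p + \sum_i f (lift ord0 i) p)).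
  by apply: Ck_add => //; apply: IH => i.
by apply/funext => p; rewrite big_ord_recl.
Qed.

Lemma Ck_linear (V W Z : normedModType R) k (U : set V) (f : V -> W)
    (L : {linear W -> Z}) :
  continuous L -> open U -> Ck k U f -> Ck k U (fun p => L (f p)).
Proof.
move=> cL oU; elim: k f => [|k IH] f.
  by move=> cf p Up; apply: continuous_comp; [exact: cf|exact: cL].
move=> [df H]; have dL q : differentiable L q by exact: linear_differentiable.
split=> [p Up|v]; first exact: differentiable_comp (df _ Up) (dL _).
apply: Ck_ext (IH _ (H v)) => // p Up.
by rewrite (diff_comp (df _ Up) (dL _))/= diff_lin.
Qed.

Lemma Ck_coord (V : normedModType R) k (U : set V) m (f : V -> 'cV[R]_m) i :
  open U -> Ck k U f -> Ck k U (fun p => f p i 0 : R^o).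
Proof.
have lin : linear (fun w : 'cV[R]_m => w i 0 : R^o).
  by move=> a v w; rewrite !mxE.
pose LM := GRing.isLinear.Build _ _ _ _ _ lin.
pose L : {linear 'cV[R]_m -> R^o} := HB.pack (fun w : 'cV[R]_m => w i 0 : R^o) LM.
by move=> oU Cf; apply: (Ck_linear (L := L)) => // p; exact: coord_continuous.
Qed.

Lemma cV_sum_delta m (w : 'cV[R]_m) : w = \sum_i w i 0 *: delta_mx i 0.
Proof.
rewrite [LHS]matrix_sum_delta; apply: eq_bigr => i _.
by rewrite big_ord1 ord1.
Qed.

(** [Ck] controls the differential of f only along fixed vectors, whereas the chain rule evaluates
    it along the moving vector ['d g p v]. Expanding that vector in coordinates, which requires the
    middle space to be finite-dimensional, gives a sum of products of C^k maps. *)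
Lemma Ck_comp (V W : normedModType R) k m (U : set V) (U' : set 'cV[R]_m)
    (f : 'cV[R]_m -> W) (g : V -> 'cV[R]_m) :
  open U -> (forall p, U p -> U' (g p)) ->
  Ck k U' f -> Ck k U g -> Ck k U (f \o g).
Proof.
move=> oU gU; elim: k f g gU => [|k IH] f g gU.
  move=> cf cg p Up; apply: continuous_comp; first exact: cg.
  exact/cf/gU.
move=> [df Hf] Cg; have [dg Hg] := Cg; split=> [p Up|v].
  by apply: differentiable_comp; [exact: dg|exact/df/gU].
pose h p := \sum_i 'd g p v i 0 *: ('d f (g p) (delta_mx i 0) : W).
have Ch : Ck k U h.
  apply: Ck_sum => // i; apply: Ck_scale => //; first exact/Ck_coord/Hg.
  by apply: (IH _ _ gU (Hf _)); exact: Ck_pred Cg.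
apply: Ck_ext Ch => // p Up.
rewrite (diff_comp (dg _ Up) (df _ (gU _ Up)))/= [in RHS](cV_sum_delta ('d g p v)).
by rewrite linear_sum; apply: eq_bigr => i _; rewrite linearZ.
Qed.

End CkCalculus.

(** * Charts, frames and smooth fields *)

(* Otherwise unification unfolds differentials down to [get]. *)
Local Opaque diff.

Section Charts.
Context {R : realType} {m : nat} {M : smoothManifold R m}.
Implicit Types (b c d : chart R m M) (x z : M) (U : set M).

Lemma chartK c x : atlas c -> cdom c x -> cbwd c (cfwd c x) = x.
Proof. by move=> /atlas_ok [_ _ K _ _]; exact: K. Qed.

Lemma chart_img_dom c p : atlas c -> (cfwd c @` cdom c) p ->
  cdom c (cbwd c p) /\ cfwd c (cbwd c p) = p.
Proof.
by move=> /atlas_ok [_ _ K _ _] [x cx <-]; rewrite K.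
Qed.

Lemma open_chart_img c U : atlas c -> open U -> open (cfwd c @` (U `&` cdom c)).
Proof.
move=> ac oU; have [_ oc K _ cb] := atlas_ok ac.
rewrite openE => _ [x [Ux cx] <-]; rewrite /interior.
have cp : (cfwd c @` cdom c) (cfwd c x) by exists x.
have nU : \forall q \near cfwd c x, U (cbwd c q).
  by apply: (cb _ cp); rewrite K//; exact: open_nbhs_nbhs.
have nc : \forall q \near cfwd c x, (cfwd c @` cdom c) q.
  exact: open_nbhs_nbhs.
near=> q.
have [cq qE] : cdom c (cbwd c q) /\ cfwd c (cbwd c q) = q.
  by apply: chart_img_dom => //; near: q.
by exists (cbwd c q) => //; split=> //; near: q.
Unshelve. all: by end_near. Qed.

Definition transition c d : 'cV[R]_m -> 'cV[R]_m := cfwd d \o cbwd c.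

Lemma transitionE c d x : atlas c -> cdom c x ->
  transition c d (cfwd c x) = cfwd d x.
Proof. by move=> ac cx; rewrite /transition/= chartK. Qed.

Lemma differentiable_transition c d x : atlas c -> atlas d ->
  cdom c x -> cdom d x -> differentiable (transition c d) (cfwd c x).
Proof.
move=> ac ad cx dx; have [H _] := atlas_compatible ac ad 1.
by apply: H; exists x.
Qed.

Lemma near_chart c x U : atlas c -> cdom c x -> open U -> U x ->
  \forall p \near cfwd c x, U (cbwd c p) /\ cdom c (cbwd c p).
Proof.
move=> ac cx oU Ux.
have : nbhs (cfwd c x) (cfwd c @` (U `&` cdom c)).
  by apply: open_nbhs_nbhs; split; [exact: open_chart_img|exists x].
have [_ _ K _ _] := atlas_ok ac.
by apply: filterS => _ [y [Uy cy] <-]; rewrite K.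
Qed.

Lemma diff_transition b c d x v : atlas b -> atlas c -> atlas d ->
  cdom b x -> cdom c x -> cdom d x ->
  'd (transition c d) (cfwd c x) ('d (transition b c) (cfwd b x) v)
  = 'd (transition b d) (cfwd b x) v.
Proof.
move=> ab ac ad bx cx dx.
have dbc := differentiable_transition ab ac bx cx.
have dcd := differentiable_transition ac ad cx dx.
have dcd' : differentiable (transition c d) (transition b c (cfwd b x)).
  by rewrite transitionE.
have dE : 'd (transition c d) (cfwd c x) = 'd (transition c d) (transition b c (cfwd b x)).
  by rewrite transitionE.
rewrite dE.
transitivity ('d (transition c d \o transition b c) (cfwd b x) v).
  exact/esym/(congr1 (@^~ v) (diff_comp dbc dcd')).
apply: near_eq_diff; last exact: differentiable_comp.
have [oc _ _ _ _] := atlas_ok ac.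
apply: filterS (near_chart ab bx oc cx) => p [cp bp] /=.
by rewrite /transition/= chartK.
Qed.

Lemma diff_transition_id c x v : atlas c -> cdom c x ->
  'd (transition c c) (cfwd c x) v = v.
Proof.
move=> ac cx; transitivity ('d (id : 'cV[R]_m -> 'cV[R]_m) (cfwd c x) v).
  apply: near_eq_diff; last exact: differentiable_transition.
  have [oc occ K _ _] := atlas_ok ac.
  have : nbhs (cfwd c x) (cfwd c @` cdom c).
    by apply: open_nbhs_nbhs; split=> //; exists x.
  by apply: filterS => p /(chart_img_dom ac)[_]; rewrite /transition.
by rewrite diff_val.
Qed.

(* Meaningful on the domain of c only. *)
Definition const_vf c (w : 'cV[R]_m) : vfield := fun z : M =>
  'd (transition c (chart_at z)) (cfwd c z) w.

Let cat x : atlas (chart_at x) := chart_at_atlas x.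
Let catx x : cdom (chart_at x) x := chart_at_dom x.

Lemma push_const_vf c d w z : atlas c -> atlas d -> cdom c z -> cdom d z ->
  push d z (const_vf c w z) = 'd (transition c d) (cfwd c z) w.
Proof. by move=> ac ad cz dz; exact: diff_transition. Qed.

Lemma const_vf_push c z v : atlas c -> cdom c z -> const_vf c (push c z v) z = v.
Proof.
move=> ac cz; rewrite /const_vf /push /coord.
by rewrite (diff_transition v (cat z) ac (cat z))// diff_transition_id.
Qed.

(** Thus every tangent vector at x is the value of a field smooth near x; this turns identities on
    fields into tensor identities. *)
Lemma const_vfE x w : const_vf (chart_at x) w x = w.
Proof. exact: diff_transition_id. Qed.

Lemma push_id x v : push (chart_at x) x v = v.
Proof. exact: diff_transition_id. Qed.

Lemma vrepE c X z : atlas c -> cdom c z -> vrep c X (cfwd c z) = push c z (X z).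
Proof. by move=> ac cz; rewrite /vrep chartK. Qed.

Lemma smooth_comp_transition (W : normedModType R) c d U k
    (f : 'cV[R]_m -> W) : atlas c -> atlas d -> open U ->
  Ck k (cfwd c @` (U `&` cdom c)) f ->
  Ck k (cfwd d @` (U `&` cdom c `&` cdom d)) (f \o transition d c).
Proof.
move=> ac ad oU Cf; have [oc _ _ _ _] := atlas_ok ac.
apply: Ck_comp Cf _; first by apply: open_chart_img => //; exact: openI.
  move=> _ [z [[Uz cz] dz] <-]; rewrite transitionE//.
  by exists z.
apply: Ck_sub (atlas_compatible ad ac k).
by apply: image_subset => z [[_ ?] ?].
Qed.

Lemma smooth_const_vf c w : atlas c -> smooth_vf (cdom c) (const_vf c w).
Proof.
move=> ac d ad k; have [oc _ K _ _] := atlas_ok ac.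
(* The field is read in d through the differential of a transition map, so class C^k takes C^(k+1)
   compatibility. *)
have [_ Hk] := atlas_compatible ac ad k.+1.
have odc : open (cdom d) by case: (atlas_ok ad).
have H : Ck k (cfwd c @` (cdom d `&` cdom c))
    (fun p => 'd (transition c d) p w).
  by rewrite setIC; exact: Hk.
have := smooth_comp_transition ac ad odc H.
have oI : open (cfwd d @` (cdom c `&` cdom d)) by exact: open_chart_img.
rewrite (_ : cdom d `&` cdom c `&` cdom d = cdom c `&` cdom d); last first.
  by rewrite setIC setIA setIid setIC.
apply: Ck_ext => // _ [z [cz dz] <-].
rewrite (vrepE _ ad dz) (push_const_vf _ ac ad cz dz)/=.
by rewrite (transitionE c ad dz).
Qed.

End Charts.

Section SmoothFields.
Context {R : realType} {m : nat} {M : smoothManifold R m}.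
Implicit Types (c d : chart R m M) (x z : M) (U V : set M) (f : M -> R).
Implicit Types X Y : @vfield R m M.

Lemma smooth_vf_sub U V X : V `<=` U -> smooth_vf U X -> smooth_vf V X.
Proof.
move=> VU sX c ac k; apply: Ck_sub (sX c ac k).
by apply: image_subset => z [/VU ? ?].
Qed.

Lemma smooth_vf_ext U X Y : open U -> (forall z, U z -> X z = Y z) ->
  smooth_vf U X -> smooth_vf U Y.
Proof.
move=> oU XY sX c ac k; apply: Ck_ext (sX c ac k); first exact: open_chart_img.
by move=> _ [z [Uz cz] <-]; rewrite (vrepE X ac cz) (vrepE Y ac cz) XY.
Qed.

Lemma smooth_vfZ U f X : open U -> smooth_fun U f -> smooth_vf U X ->
  smooth_vf U (fun z => f z *: X z).
Proof.
move=> oU sf sX c ac k; have oc := open_chart_img ac oU.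
apply: Ck_ext (Ck_scale oc (sf c ac k) (sX c ac k)) => //.
by move=> p _; rewrite /vrep /push linearZ.
Qed.

Lemma smooth_vf_sum U n (X : 'I_n -> @vfield R m M) : open U ->
  (forall i, smooth_vf U (X i)) -> smooth_vf U (fun z => \sum_i X i z).
Proof.
move=> oU sX c ac k; have oc := open_chart_img ac oU.
apply: Ck_ext (Ck_sum oc (fun i => sX i c ac k)) => //.
by move=> p _; rewrite /vrep /push linear_sum.
Qed.

Lemma smooth_coords c U X i : atlas c -> open U -> smooth_vf U X ->
  smooth_fun (U `&` cdom c) (fun z => push c z (X z) i 0).
Proof.
move=> ac oU sX d ad k; have oc := open_chart_img ac oU.
have oc' : open (cdom c) by case: (atlas_ok ac).
have := smooth_comp_transition ac ad oU (Ck_coord i oc (sX c ac k)).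
apply: Ck_ext; first by apply: open_chart_img => //; exact: openI.
move=> _ [z [[Uz cz] dz] <-] /=.
by rewrite (transitionE c ad dz) (vrepE X ac cz) (chartK ad dz).
Qed.

Lemma smooth_near2 x X Y : smooth_vf_near x X -> smooth_vf_near x Y ->
  exists U, [/\ open U, U x, smooth_vf U X & smooth_vf U Y].
Proof.
move=> [U [oU Ux sX]] [V [oV Vx sY]]; exists (U `&` V); split=> //.
- exact: openI.
- by apply: smooth_vf_sub sX => z [].
- by apply: smooth_vf_sub sY => z [].
Qed.

Lemma smooth_near_endo x U (J : M -> 'M[R]_m) X : open U -> U x ->
  smooth_endo U J -> smooth_vf_near x X -> smooth_vf_near x (fun z => J z *m X z).
Proof.
move=> oU Ux sJ [V [oV Vx sX]]; exists (U `&` V); split=> //; first exact: openI.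
apply: sJ; first exact: openI; first by move=> z [].
by apply: smooth_vf_sub sX => z [].
Qed.

Lemma smooth_near_const x w : smooth_vf_near x (const_vf (chart_at x) w).
Proof.
exists (cdom (chart_at x)); split; last exact/smooth_const_vf/chart_at_atlas.
  by case: (atlas_ok (chart_at_atlas x)).
exact: chart_at_dom.
Qed.

Lemma smooth_fun_differentiable x f : smooth_fun_near x f ->
  differentiable (f \o cbwd (chart_at x) : 'cV[R]_m -> R^o) (Defs.coord x).
Proof.
move=> [U [oU Ux sf]]; have [H _] := sf _ (chart_at_atlas x) 1.
by apply: H; exists x; split=> //; exact: chart_at_dom.
Qed.

Lemma dir_ext x v U f g : open U -> U x -> (forall z, U z -> f z = g z) ->
  smooth_fun_near x f -> dir x v f = dir x v g.
Proof.
move=> oU Ux fg sf; apply: near_eq_diff; last exact: smooth_fun_differentiable.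
have := near_chart (chart_at_atlas x) (chart_at_dom x) oU Ux.
by apply: filterS => p [Up _] /=; rewrite fg.
Qed.

Lemma dirP x a v w f : dir x (a *: v + w) f = a * dir x v f + dir x w f.
Proof. exact: linearP. Qed.

Lemma dir_cst x v (a : R) : dir x v (fun _ : M => a) = 0.
Proof. by rewrite /dir (_ : _ \o _ = cst a)// diff_cst. Qed.

End SmoothFields.

(** * Differences of connections *)

Section Form.
Context {R : realType} {m : nat}.
Implicit Types (b J B : 'M[R]_m) (u v w : 'cV[R]_m).

Lemma formDl b u v w : form b (u + v) w = form b u w + form b v w.
Proof. by rewrite /form linearD/= !mulmxDl mxE. Qed.

Lemma formZl b a v w : form b (a *: v) w = a * form b v w.
Proof. by rewrite /form linearZ/= -!scalemxAl mxE. Qed.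

Lemma formDr b u v w : form b u (v + w) = form b u v + form b u w.
Proof. by rewrite /form !mulmxDr mxE. Qed.

Lemma formZr b a v w : form b v (a *: w) = a * form b v w.
Proof. by rewrite /form -!scalemxAr mxE. Qed.

Lemma formNl b v w : form b (- v) w = - form b v w.
Proof. by rewrite -scaleN1r formZl mulN1r. Qed.

Lemma formBl b u v w : form b (u - v) w = form b u w - form b v w.
Proof. by rewrite formDl formNl. Qed.

Lemma form_skew b v w : b^T = - b -> form b v w = - form b w v.
Proof.
move=> bT; rewrite /form.
have -> : v^T *m b *m w = - (w^T *m b *m v)^T.
  by rewrite !trmx_mul trmxK bT mulNmx mulmxN opprK mulmxA.
by rewrite !mxE.
Qed.

Lemma form_nondeg b u : b \in unitmx -> (forall w, form b u w = 0) -> u = 0.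
Proof.
move=> ub H; have ub0 : u^T *m b = 0.
  apply/rowP => j; rewrite [RHS]mxE -(H (delta_mx j 0)).
  by rewrite /form -colE [RHS]mxE.
by apply: trmx_inj; rewrite trmx0 -[u^T](mulmxK ub) ub0 mul0mx.
Qed.

Lemma form_inj b u v : b \in unitmx -> (forall w, form b u w = form b v w) -> u = v.
Proof.
move=> ub H; apply/eqP; rewrite -subr_eq0; apply/eqP/(form_nondeg ub) => w.
by rewrite formBl H subrr.
Qed.

End Form.

Definition bilin (R : realType) (m : nat)
    (B : 'cV[R]_m -> 'cV[R]_m -> 'cV[R]_m) : Prop :=
  (forall w, linear (B^~ w)) /\ (forall v, linear (B v)).

Section Connections.
Context {R : realType} {m : nat} {M : smoothManifold R m}.
Implicit Types (c d : chart R m M) (x z : M) (U V : set M) (f g : M -> R).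
Implicit Types (X Y Z : @vfield R m M) (D : covder M).

Definition diff_at x f := differentiable
  (f \o cbwd (chart_at x) : 'cV[R]_m -> R^o) (Defs.coord x).

Lemma dirD x v f g : diff_at x f -> diff_at x g ->
  diff_at x (fun z => f z + g z) /\
  dir x v (fun z => f z + g z) = dir x v f + dir x v g.
Proof.
move=> df dg; split; first exact: differentiableD df dg.
exact: (congr1 (@^~ v) (diffD df dg)).
Qed.

Lemma dirM x v f g : diff_at x f -> diff_at x g ->
  diff_at x (fun z => f z * g z) /\
  dir x v (fun z => f z * g z) = f x * dir x v g + g x * dir x v f.
Proof.
move=> df dg; have [H1 H2] := diff_scale df dg.
split; first exact: H1.
rewrite /dir; etransitivity; first exact: (H2 v).
rewrite addrC /=; congr (_ + _).
  by rewrite /Defs.coord (chartK (chart_at_atlas x) (chart_at_dom x)).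
rewrite /Defs.coord (chartK (chart_at_atlas x) (chart_at_dom x)).
by rewrite [LHS]mulrC.
Qed.

Lemma dirZ x v a f : diff_at x f ->
  diff_at x (fun z => a * f z) /\ dir x v (fun z => a * f z) = a * dir x v f.
Proof.
move=> df; have [H1 H2] := dirM v (differentiable_cst (a : R^o) _ : diff_at x (fun=> a)) df.
by split=> //; rewrite H2 dir_cst mulr0 addr0.
Qed.

Section Additivity.
Variables (D : covder M) (hD : is_connection D).

Lemma conn_linl x v w a Y : smooth_vf_near x Y ->
  D x (a *: v + w) Y = a *: D x v Y + D x w Y.
Proof. by move=> sY; rewrite (hD.1 _ _ _ _ _ sY). Qed.

Lemma connD x v Y Z : smooth_vf_near x Y -> smooth_vf_near x Z ->
  D x v (fun z => Y z + Z z) = D x v Y + D x v Z.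
Proof. by case: hD => _ [H _]; exact: H. Qed.

Lemma conn_leibniz x v f Y : smooth_fun_near x f -> smooth_vf_near x Y ->
  D x v (fun z => f z *: Y z) = dir x v f *: Y x + f x *: D x v Y.
Proof. by case: hD => _ [_ [H _]]; exact: H. Qed.

Lemma conn_local x v U Y Z : open U -> U x -> smooth_vf U Y -> smooth_vf U Z ->
  (forall z, U z -> Y z = Z z) -> D x v Y = D x v Z.
Proof. by case: hD => _ [_ [_ [H _]]]; exact: H. Qed.

Lemma conn_sum x v n U (X : 'I_n -> @vfield R m M) : open U -> U x ->
  (forall i, smooth_vf U (X i)) ->
  D x v (fun z => \sum_i X i z) = \sum_i D x v (X i).
Proof.
move=> oU Ux; elim: n X => [|n IH] X sX.
  rewrite big_ord0 (_ : (fun _ => _) = (fun=> 0)); last first.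
    by apply/funext => z; rewrite big_ord0.
  (* The zero field is smooth as an empty sum; additivity then gives D 0 = D 0 + D 0. *)
  have s0 : smooth_vf_near x (fun=> 0 : 'cV[R]_m).
    exists U; split=> //; have := smooth_vf_sum oU (X := fun _ : 'I_0 => (fun=> 0)).
    by move/(_ (fun i => match i with Ordinal _ h => False_ind _ (notF h) end));
      apply: smooth_vf_ext => // z _; rewrite big_ord0.
  have /eqP := connD v s0 s0.
  have -> : (fun z : M => (0 : 'cV[R]_m) + 0) = (fun=> 0).
    by apply/funext => z; rewrite addr0.
  by rewrite -subr_eq0 opprD addrA subrr sub0r oppr_eq0 => /eqP.
rewrite (_ : (fun _ => _) = (fun z => X ord0 z + \sum_i X (lift ord0 i) z)).
  rewrite big_ord_recl -(IH (fun i => X (lift ord0 i))) => [|i]; last exact: sX.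
  apply: connD; first by exists U.
  by exists U; split=> //; apply: smooth_vf_sum => // i; exact: sX.
by apply/funext => z; rewrite big_ord_recl.
Qed.

Lemma conn_frame x v Y : smooth_vf_near x Y ->
  D x v Y = \sum_i (dir x v (fun z => push (chart_at x) z (Y z) i 0) *:
                      const_vf (chart_at x) (delta_mx i 0) x
                    + Y x i 0 *: D x v (const_vf (chart_at x) (delta_mx i 0))).
Proof.
move=> [U0 [oU0 U0x sY]]; set c := chart_at x.
have ac : atlas c by exact: chart_at_atlas.
have cx : cdom c x by exact: chart_at_dom.
have oc : open (cdom c) by case: (atlas_ok ac).
set U := U0 `&` cdom c; have oU : open U by exact: openI.
have Ux : U x by [].
pose f i z := push c z (Y z) i 0.
have sf i : smooth_fun U (f i) by exact: smooth_coords.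
have sE i : smooth_vf U (const_vf c (delta_mx i 0)).
  by apply: smooth_vf_sub (smooth_const_vf _ ac) => z [].
have sfE i : smooth_vf U (fun z => f i z *: const_vf c (delta_mx i 0) z).
  by apply: smooth_vfZ.
have sYU : smooth_vf U Y by apply: smooth_vf_sub sY => z [].
rewrite (conn_local v oU Ux sYU (smooth_vf_sum oU sfE)); last first.
  move=> z [_ cz]; rewrite -[LHS](const_vf_push (Y z) ac cz).
  rewrite [in LHS](cV_sum_delta (push c z (Y z))) /const_vf linear_sum.
  by apply: eq_bigr => i _; rewrite linearZ.
rewrite (conn_sum v oU Ux sfE); apply: eq_bigr => i _.
rewrite (conn_leibniz v); last 2 first.
- by exists U.
- by exists U.
by rewrite /f /c push_id.
Qed.

End Additivity.

(** In the coordinate frame at x, the terms differentiating the coefficients of Y are common to both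
    connections and cancel; the rest involves only the value of Y at x. *)
Lemma connection_diff D1 D2 x : is_connection D1 -> is_connection D2 ->
  exists2 S, bilin S & forall v Y, smooth_vf_near x Y ->
    D1 x v Y - D2 x v Y = S v (Y x).
Proof.
move=> h1 h2; pose E i := const_vf (chart_at x) (delta_mx i 0).
exists (fun v w => \sum_i w i 0 *: (D1 x v (E i) - D2 x v (E i))).
  split=> [w a u v|v a w u]; rewrite scaler_sumr -big_split; apply: eq_bigr => i _.
    have sE : smooth_vf_near x (E i) by exact: smooth_near_const.
    rewrite (conn_linl h1 _ _ _ sE) (conn_linl h2 _ _ _ sE).
    by apply/colP => j; rewrite !mxE; ring.
  by apply/colP => j; rewrite !mxE; ring.
move=> v Y sY; rewrite (conn_frame h1 _ sY) (conn_frame h2 _ sY) -sumrB.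
by apply: eq_bigr => i _; rewrite opprD addrACA subrr add0r -scalerBr.
Qed.

Lemma torsion_diff D1 D2 x (T1 T2 S : 'cV[R]_m -> 'cV[R]_m -> 'cV[R]_m) :
  (forall v Y, smooth_vf_near x Y -> D1 x v Y - D2 x v Y = S v (Y x)) ->
  is_torsion_at D1 x T1 -> is_torsion_at D2 x T2 ->
  forall v w, T1 v w - T2 v w = S v w - S w v.
Proof.
move=> DS t1 t2 v w; pose X u : @vfield R m M := const_vf (chart_at x) u.
have sX u : smooth_vf_near x (X u) by exact: smooth_near_const.
have Xx u : X u x = u by exact: const_vfE.
have := t1 _ _ (sX v) (sX w); have := t2 _ _ (sX v) (sX w).
rewrite /torsion !Xx => <- <-.
have := DS v _ (sX w); have := DS w _ (sX v); rewrite !Xx => <- <-.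
by apply/colP => j; rewrite !mxE; ring.
Qed.

(** The commutator of [S v] with a local section of Q is the difference of its two covariant
    derivatives, both in Q. The admissible basis provides local sections, and linearity reaches
    every J in [Q x]. *)
Lemma preserves_Q_diff (Q : M -> set 'M[R]_m) D1 D2 x S :
  almost_quaternionic Q -> preserves_Q Q D1 -> preserves_Q Q D2 ->
  (forall v Y, smooth_vf_near x Y -> D1 x v Y - D2 x v Y = S v (Y x)) ->
  bilin S -> forall v J, Q x J ->
  exists2 B, Q x B & forall w, S v (J *m w) - J *m S v w = B *m w.
Proof.
move=> aq p1 p2 DS bS v J; have [U [J1 [J2 [J3 [oU Ux [s1 s2 s3 HQ]]]]]] := aq x.
have key K : smooth_endo U K -> (forall z, U z -> Q z (K z)) ->
    exists2 B, Q x B & forall w, S v (K x *m w) - K x *m S v w = B *m w.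
  move=> sK QK; have [B1 QB1 e1] := p1 x v U K oU Ux sK QK.
  have [B2 QB2 e2] := p2 x v U K oU Ux sK QK.
  exists (B1 - B2).
    move: QB1 QB2; have [_ _ _ _ ->] := HQ x Ux.
    move=> [a1 [a2 [a3 ->]]] [b1 [b2 [b3 ->]]].
    exists (a1 - b1), (a2 - b2), (a3 - b3).
    by apply/matrixP => i j; rewrite !mxE; ring.
  move=> w; pose X : @vfield R m M := const_vf (chart_at x) w.
  have sX : smooth_vf_near x X by exact: smooth_near_const.
  have Xx : X x = w by exact: const_vfE.
  have sKX := smooth_near_endo oU Ux sK sX.
  have := DS v _ sKX; have := DS v _ sX; rewrite Xx => <- <-.
  rewrite mulmxBl mulmxBr; have := e1 _ sX; have := e2 _ sX; rewrite Xx => <- <-.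
  by apply/colP => j; rewrite !mxE; ring.
have QE z : U z -> [/\ Q z (J1 z), Q z (J2 z) & Q z (J3 z)].
  move=> Uz; have [_ _ _ _ ->] := HQ z Uz; split.
  - by exists 1, 0, 0; rewrite scale1r !scale0r !addr0.
  - by exists 0, 1, 0; rewrite scale1r !scale0r addr0 add0r.
  - by exists 0, 0, 1; rewrite scale1r !scale0r !add0r.
have [B1 Q1 E1] := key _ s1 (fun z Uz => let: And3 h _ _ := QE z Uz in h).
have [B2 Q2 E2] := key _ s2 (fun z Uz => let: And3 _ h _ := QE z Uz in h).
have [B3 Q3 E3] := key _ s3 (fun z Uz => let: And3 _ _ h := QE z Uz in h).
move: Q1 Q2 Q3; have [_ _ _ _ ->] := HQ x Ux.
move=> [a1 [a2 [a3 B1E]]] [b1 [b2 [b3 B2E]]] [c1 [c2 [c3 B3E]]] [t1 [t2 [t3 ->]]].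
exists (t1 *: B1 + t2 *: B2 + t3 *: B3).
  rewrite B1E B2E B3E; exists (t1 * a1 + t2 * b1 + t3 * c1),
    (t1 * a2 + t2 * b2 + t3 * c2), (t1 * a3 + t2 * b3 + t3 * c3).
  by apply/matrixP => i j; rewrite !mxE; ring.
move=> w; rewrite !mulmxDl -!scalemxAl -E1 -E2 -E3.
have linS a u u' : S v (a *: u + u') = a *: S v u + S v u' by exact: bS.2.
rewrite -addrA linS linS -[t3 *: _]addr0 linS.
have -> : S v 0 = 0 by have := linS (-1) 0 0; rewrite scaler0 addr0 scaleN1r addNr.
by apply/colP => j; rewrite !mxE; ring.
Qed.

End Connections.

(** * The tensor relating the canonical connection to the Oproiu connection *)

Section CanonicalDifference.
Context {R : realType} {m : nat} {M : smoothManifold R m}.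
Variables (Q : M -> set 'M[R]_m) (omega : M -> 'M[R]_m).
Hypothesis hQ : almost_quaternionic_skew_hermitian Q omega.
Implicit Types (x z : M) (U V : set M) (X Y Z : @vfield R m M).

Let aq : almost_quaternionic Q := hQ.1.
Let omegaT x : (omega x)^T = - omega x.
Proof. by have [_ [_ H _ _]] := hQ. Qed.
Let omegaU x : omega x \in unitmx.
Proof. by have [_ [_ _ H _]] := hQ. Qed.
Let omega_sk x v w : form (omega x) v w = - form (omega x) w v.
Proof. exact: form_skew. Qed.

Lemma form_smooth_near x Y Z : smooth_vf_near x Y -> smooth_vf_near x Z ->
  smooth_fun_near x (fun z => form (omega z) (Y z) (Z z)).
Proof.
move=> sY sZ; have [U [oU Ux sY' sZ']] := smooth_near2 sY sZ.
by exists U; split=> //; have [_ [H _ _ _]] := hQ; exact: H.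
Qed.

Lemma form_diff_at x Y Z : smooth_vf_near x Y -> smooth_vf_near x Z ->
  diff_at x (fun z => form (omega z) (Y z) (Z z)).
Proof.
by move=> sY sZ; apply: smooth_fun_differentiable; exact: form_smooth_near.
Qed.

(** An induction principle: smooth extension, square -1 and invariance of [omega] are available for
    the members of an admissible basis, and a property linear in J passes from them to all of
    [Q x]. *)
Lemma Q_comb (P : 'M[R]_m -> Prop) x : 
  (forall a B C, P B -> P C -> P (a *: B + C)) ->
  (forall U J, open U -> U x -> smooth_endo U J ->
     (forall z, U z -> [/\ Q z (J z), J z *m J z = - 1%:M &
        forall v w, form (omega z) (J z *m v) (J z *m w) = form (omega z) v w]) ->
     P (J x)) ->
  forall J, Q x J -> P J.
Proof.
move=> Plin PJ J; have [U [J1 [J2 [J3 [oU Ux adm]]]]] := aq x.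
have [_ [_ _ _ inv]] := hQ; have [s1 s2 s3 HQ] := adm.
have [P1 P2 P3] : [/\ P (J1 x), P (J2 x) & P (J3 x)].
  split.
  - apply: (PJ U) => // z Uz; have [-> _ _ _ ->] := HQ z Uz; split=> //.
      by exists 1, 0, 0; rewrite scale1r !scale0r !addr0.
    by move=> v w; have [] := inv U J1 J2 J3 oU adm z v w Uz.
  - apply: (PJ U) => // z Uz; have [_ -> _ _ ->] := HQ z Uz; split=> //.
      by exists 0, 1, 0; rewrite scale1r !scale0r addr0 add0r.
    by move=> v w; have [] := inv U J1 J2 J3 oU adm z v w Uz.
  - apply: (PJ U) => // z Uz; have [_ _ -> _ ->] := HQ z Uz; split=> //.
      by exists 0, 0, 1; rewrite scale1r !scale0r !add0r.
    by move=> v w; have [] := inv U J1 J2 J3 oU adm z v w Uz.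
have [_ _ _ _ ->] := HQ x Ux; move=> [a1 [a2 [a3 ->]]].
have P0 : P 0 by have := Plin (-1) _ _ P1 P1; rewrite scaleN1r addNr.
rewrite -addrA; apply: (Plin) => //; apply: (Plin) => //.
by rewrite -[_ *: _]addr0; exact: Plin.
Qed.

Lemma Q_skew x J v w : Q x J ->
  form (omega x) (J *m v) w = - form (omega x) v (J *m w).
Proof.
move=> QJ; move: J QJ v w; apply: (Q_comb (P := fun J => forall v w,
  form (omega x) (J *m v) w = - form (omega x) v (J *m w)))
  => [a B C hB hC v w|U J oU Ux sJ HJ v w].
  by rewrite !mulmxDl -!scalemxAl !(formDl, formDr, formZl, formZr) hB hC; ring.
have [_ J2 inv] := HJ x Ux.
by rewrite -inv mulmxA J2 mulNmx mul1mx formNl.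
Qed.

Variables (D0 : covder M) (A : M -> 'cV[R]_m -> 'cV[R]_m -> 'cV[R]_m).
Hypothesis hD0 : is_connection D0.
Hypothesis hQD0 : preserves_Q Q D0.
Hypothesis hA : forall x v Y Z, smooth_vf_near x Y -> smooth_vf_near x Z ->
  form (omega x) (A x v (Y x)) (Z x) = 2^-1 * nabla_form D0 omega x v Y Z.

Let K x w : @vfield R m M := const_vf (chart_at x) w.
Let sK x w : smooth_vf_near x (K x w) := smooth_near_const x w.
Let Kx x w : K x w x = w := const_vfE x w.

Let AE x v w u :
  form (omega x) (A x v w) u = 2^-1 * nabla_form D0 omega x v (K x w) (K x u).
Proof. by rewrite -hA// !Kx. Qed.

Lemma A_skew x v w u : form (omega x) (A x v w) u = - form (omega x) (A x v u) w.
Proof.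
rewrite !AE /nabla_form.
have -> : (fun z => form (omega z) (K x w z) (K x u z))
    = (fun z => -1 * form (omega z) (K x u z) (K x w z)).
  by apply/funext => z; rewrite mulN1r; exact: form_skew.
rewrite (dirZ v (-1) (form_diff_at (sK x u) (sK x w))).2.
rewrite [form _ (D0 _ _ (K x w)) _]omega_sk [form _ _ (D0 _ _ (K x u))]omega_sk.
by ring.
Qed.

Lemma A_bilin x : bilin (A x).
Proof.
have linl w : linear (A x ^~ w).
  move=> a v v'; apply: (form_inj (omegaU x)) => u.
  rewrite formDl formZl !AE /nabla_form dirP.
  rewrite !(conn_linl hD0 _ _ _ (sK _ _)) !(formDl, formDr, formZl, formZr).
  by ring.
split=> // v a w w'; apply: (form_inj (omegaU x)) => u.
rewrite A_skew formDl formZl [in RHS]A_skew [form _ (A x v w') u]A_skew.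
by rewrite formDr formZr; ring.
Qed.

(** Differentiate omega(JY, Z) = - omega(Y, JZ) along v. The covariant derivative B of J lies in Q,
    so it is skew for [omega] as well, and its contributions cancel. *)
Lemma A_commutes x v w J : Q x J -> A x v (J *m w) = J *m A x v w.
Proof.
have [linl linr] := A_bilin x.
have linr' a b c : A x v (a *: b + c) = a *: A x v b + A x v c by exact: linr.
move=> QJ; move: J QJ w; apply: (Q_comb (P := fun J => forall w,
  A x v (J *m w) = J *m A x v w)) => [a B C hB hC w|U J oU Ux sJ HJ w].
  by rewrite !mulmxDl -!scalemxAl linr' hB hC.
have [QJ J2 inv] := HJ x Ux.
have [B QB HB] := hQD0 v oU Ux sJ (fun z Uz => let: And3 h _ _ := HJ z Uz in h).
apply: (form_inj (omegaU x)) => u.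
have skJ z a b : U z -> form (omega z) (J z *m a) b = - form (omega z) a (J z *m b).
  by move=> Uz; apply: Q_skew; have [] := HJ z Uz.
have sJK a := smooth_near_endo oU Ux sJ (sK x a).
have DJ a : D0 x v (fun z => J z *m K x a z) = J x *m D0 x v (K x a) + B *m a.
  by have := HB _ (sK x a); rewrite Kx => <-; rewrite addrC subrK.
have := hA v (sJK w) (sK x u); have := hA v (sK x w) (sJK u).
rewrite !Kx (skJ x)// => -> ->; rewrite /nabla_form !DJ.
have -> : dir x v (fun z => form (omega z) (J z *m K x w z) (K x u z)) =
    dir x v (fun z => -1 * form (omega z) (K x w z) (J z *m K x u z)).
  apply: (dir_ext v oU Ux) => [z Uz|]; first by rewrite mulN1r skJ.
  exact: form_smooth_near (sJK w) (sK x u).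
rewrite (dirZ v (-1) (form_diff_at (sK x w) (sJK u))).2.
rewrite !(formDl, formDr) !(skJ x)// (Q_skew _ _ QB) !Kx.
by ring.
Qed.

End CanonicalDifference.

(** * The Pfaffian sum *)

Section Pairs.
Variables (m k : nat) (e : m = k.*2).

Lemma lo_subproof (a : 'I_k) : (a.*2 < m)%N.
Proof. by rewrite e ltn_double. Qed.
Lemma hi_subproof (a : 'I_k) : (a.*2.+1 < m)%N.
Proof. by rewrite e ltn_Sdouble. Qed.
Lemma hf_subproof (j : 'I_m) : (j./2 < k)%N.
Proof. by have := ltn_ord j; rewrite [X in (_ < X)%N]e; lia. Qed.
Definition lo a : 'I_m := Ordinal (lo_subproof a).
Definition hi a : 'I_m := Ordinal (hi_subproof a).
Definition hf j : 'I_k := Ordinal (hf_subproof j).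

Lemma lo_even a : odd (lo a) = false. Proof. by rewrite /= odd_double. Qed.
Lemma hi_odd a : odd (hi a). Proof. by rewrite /= odd_double. Qed.
Lemma hf_lo a : hf (lo a) = a. Proof. by apply: val_inj; rewrite /= doubleK. Qed.
Lemma hf_hi a : hf (hi a) = a. Proof. by apply: val_inj => /=; rewrite uphalf_double. Qed.
Lemma lohiE (j : 'I_m) : j = if odd j then hi (hf j) else lo (hf j).
Proof. by apply: val_inj => /=; case: ifP => /=; lia. Qed.

Lemma prod_pairs (K : comPzSemiRingType) (F : 'I_m -> 'I_m -> K) :
  \prod_(ij : 'I_m * 'I_m | ~~ odd ij.1 && (ij.2 == ij.1.+1 :> nat)) F ij.1 ij.2
  = \prod_a F (lo a) (hi a).
Proof.
rewrite (reindex_onto (fun a => (lo a, hi a)) (fun ij => hf ij.1)) /=.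
  by apply: eq_bigl => a; rewrite odd_double eqxx /= hf_lo eqxx.
move=> [i j] /= /andP[oi /eqP ij]; rewrite [in RHS](lohiE i) (negbTE oi).
congr (_, _); apply: val_inj => /=; lia.
Qed.

Lemma big_lohi (V : Type) (idx : V) (op : Monoid.com_law idx) (H : 'I_m -> V) :
  \big[op/idx]_j H j = \big[op/idx]_a op (H (lo a)) (H (hi a)).
Proof.
rewrite big_split (bigID (fun j : 'I_m => odd j)) /= Monoid.mulmC; congr (op _ _).
  rewrite (reindex_onto lo hf) /=.
    by apply: eq_bigl => a; rewrite odd_double /= hf_lo eqxx.
  by move=> j oj; rewrite [RHS]lohiE (negbTE oj).
rewrite (reindex_onto hi hf) /=.
  by apply: eq_bigl => a; rewrite odd_double /= hf_hi eqxx.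
by move=> j oj; rewrite [RHS]lohiE oj.
Qed.

(* The sum defining the Pfaffian, without the usual factor 1 / (2^k k!). *)
Definition pf (K : comPzRingType) (O : 'M[K]_m) : K :=
  \sum_(s : 'S_m) (-1) ^+ s * \prod_a O (s (lo a)) (s (hi a)).

(** Multiply out every entry of the congruence and exchange the sums: for each choice g of two row
    indices per factor, the signed sum over s is a determinant of rows of W. *)
Lemma pf_expand (K : comNzRingType) (W O : 'M[K]_m) :
  pf (W^T *m O *m W) = \sum_(g : {ffun 'I_k -> 'I_m * 'I_m})
    (\prod_a O (g a).1 (g a).2) *
    \det (\matrix_(i < m, j < m) W (if odd i then (g (hf i)).2 else (g (hf i)).1) j).
Proof.
transitivity (\sum_(s : 'S_m) \sum_(g : {ffun 'I_k -> 'I_m * 'I_m})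
    (\prod_a O (g a).1 (g a).2) * ((-1) ^+ s *
      \prod_(i < m) W (if odd i then (g (hf i)).2 else (g (hf i)).1) (s i))).
  apply: eq_bigr => s _.
  have -> : \prod_a (W^T *m O *m W) (s (lo a)) (s (hi a)) =
     \prod_a \sum_(x : 'I_m * 'I_m)
        O x.1 x.2 * (W x.1 (s (lo a)) * W x.2 (s (hi a))).
    apply: eq_bigr => a _; rewrite mxE.
    under eq_bigr => j _.
      rewrite mxE big_distrl /=.
      under eq_bigr => i _ do rewrite !mxE [_ * O i j]mulrC -mulrA.
      over.
    by rewrite exchange_big pair_bigA.
  rewrite bigA_distr_bigA mulr_sumr; apply: eq_bigr => g _.
  rewrite big_split /= mulrCA; congr (_ * (_ * _)).
  rewrite [RHS]big_lohi; apply: eq_bigr => a _.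
  by rewrite hi_odd lo_even hf_lo hf_hi.
rewrite exchange_big; apply: eq_bigr => g _ /=.
rewrite -mulr_sumr; congr (_ * _); apply: eq_bigr => s _; congr (_ * _).
by apply: eq_bigr => i _; rewrite mxE.
Qed.

(** Selecting rows of W amounts to multiplying W on the left by the selected rows of the identity,
    so each determinant in the expansion is the corresponding one for W = 1 times [\det W]. *)
Lemma pf_mul (K : comNzRingType) (W O : 'M[K]_m) :
  pf (W^T *m O *m W) = pf O * \det W.
Proof.
have -> : pf O = pf (1%:M^T *m O *m 1%:M) by rewrite trmx1 mul1mx mulmx1.
rewrite !pf_expand.
rewrite mulr_suml; apply: eq_bigr => g _; rewrite -mulrA -det_mulmx.
congr (_ * \det _); apply/matrixP => i j; rewrite !mxE.
rewrite (bigD1 (if odd i then (g (hf i)).2 else (g (hf i)).1)) //= !mxE eqxx mul1r.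
rewrite big1 ?addr0 // => l nl; rewrite !mxE eq_sym (negbTE nl) mul0r //.
Qed.

(** The standard symplectic matrix: a block with rows (0, 1) and (-1, 0) on each pair of indices. *)
Definition stdJ (K : pzRingType) : 'M[K]_m :=
  \matrix_(p, q) ((hf p == hf q)%:R * ((odd q)%:R - (odd p)%:R)).

Definition flip (j : 'I_m) : 'I_m := if odd j then lo (hf j) else hi (hf j).
Lemma flipK : involutive flip.
Proof.
move=> j; rewrite [RHS]lohiE; case: (boolP (odd j)) => oj.
  by rewrite {2}/flip oj /flip lo_even hf_lo.
by rewrite {2}/flip (negbTE oj) /flip hi_odd hf_hi.
Qed.
Lemma odd_flip (j : 'I_m) : odd (flip j) = ~~ odd j.
Proof. by rewrite /flip; case: ifP => oj; rewrite ?hi_odd ?lo_even. Qed.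
Lemma hf_inj_flip i j : hf i = hf j -> i = j \/ i = flip j.
Proof.
move=> h; have Ej := lohiE j.
have Ei : i = if odd i then hi (hf j) else lo (hf j) by rewrite -h -lohiE.
rewrite /flip; case: (odd i) Ei => Ei; case: (odd j) Ej => Ej.
- by left; rewrite Ei.
- by right.
- by right.
- by left; rewrite Ei.
Qed.

(* s is t * t^flip, where t is s on even indices and the identity on odd ones. *)
Lemma even_perm_sign (s : 'S_m) : (forall a, hf (s (lo a)) = hf (s (hi a))) ->
  (forall a, ~~ odd (s (lo a))) -> odd_perm s = false.
Proof.
move=> hs es.
have sflip j : s (flip j) = flip (s j).
  have h : hf (s (flip j)) = hf (s j).
    by rewrite /flip [j in RHS]lohiE; case: ifP => _; rewrite hs.
  case: (hf_inj_flip h) => // /perm_inj fj.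
  by have := odd_flip j; rewrite fj; case: (odd j).
have so j : odd (s j) = odd j.
  rewrite (lohiE j); case: ifP => oj; last by rewrite lo_even; apply/negbTE/es.
  have -> : hi (hf j) = flip (lo (hf j)) by rewrite /flip lo_even hf_lo.
  by rewrite sflip !odd_flip lo_even es.
pose t0 (j : 'I_m) := if odd j then j else s j.
have t0_inj : injective t0.
  move=> i j; rewrite /t0; case: ifP => oi; case: ifP => oj //.
  - by move=> ij; have := so j; rewrite -ij oi oj.
  - by move=> ij; have := so i; rewrite ij oi oj.
  - exact: perm_inj.
pose t := perm t0_inj; pose f := perm (inv_inj flipK).
have -> : s = (t * t ^ f)%g.
  apply/permP => j; rewrite permM conjgE !permM.
  have fV x : (f^-1)%g x = flip x.
    by apply: (@perm_inj _ f); rewrite permKV permE flipK.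
  rewrite fV !permE /t0; case: (boolP (odd j)) => oj.
    by rewrite odd_flip oj /= sflip flipK.
  by rewrite odd_flip so (negbTE oj) /= flipK.
by rewrite odd_permM odd_permJ addbb.
Qed.

(* Swapping the values of s at lo a and hi a changes both signs, which reduces
   to a permutation preserving parity. *)
Lemma pf_stdJ_term (K : comNzRingType) (s : 'S_m) :
  (forall a, hf (s (lo a)) = hf (s (hi a))) ->
  (-1) ^+ s * \prod_a stdJ K (s (lo a)) (s (hi a)) = 1.
Proof.
have [c] := ubnP #|[pred a | odd (s (lo a))]|.
elim: c s => // c IH s lt_c hs.
have [/existsP[a oa]|/existsPn es] := boolP [exists a, odd (s (lo a))]; last first.
  rewrite (even_perm_sign hs es) mul1r big1 // => a _.
  rewrite mxE hs eqxx mul1r (negbTE (es a)).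
  suff -> : odd (s (hi a)) by rewrite subr0.
  case: (hf_inj_flip (hs a)) => [/perm_inj h|h].
    by have := hi_odd a; rewrite -h lo_even.
  by have := es a; rewrite h odd_flip negbK.
have loha : lo a != hi a by apply/eqP => h; have := hi_odd a; rewrite -h lo_even.
have s'lo b : b != a -> tperm (lo a) (hi a) (lo b) = lo b.
  move=> ba; apply: tpermD; apply/eqP => h.
    by move: ba; rewrite -(hf_lo b) -h hf_lo eqxx.
  by have := hi_odd a; rewrite h lo_even.
have s'hi b : b != a -> tperm (lo a) (hi a) (hi b) = hi b.
  move=> ba; apply: tpermD; apply/eqP => h.
    by have := hi_odd b; rewrite -h lo_even.
  by move: ba; rewrite -(hf_hi b) -h hf_hi eqxx.
have ohi : ~~ odd (s (hi a)).
  case: (hf_inj_flip (hs a)) => [/perm_inj h|h]; first by rewrite h eqxx in loha.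
  by move: oa; rewrite h odd_flip.
have := IH (tperm (lo a) (hi a) * s)%g; rewrite odd_mul_tperm loha.
rewrite (bigD1 a) //= !permM tpermL tpermR [in X in _ -> X](bigD1 a) //=.
have -> : \prod_(i | i != a) stdJ K ((tperm (lo a) (hi a) * s)%g (lo i))
    ((tperm (lo a) (hi a) * s)%g (hi i)) =
    \prod_(i | i != a) stdJ K (s (lo i)) (s (hi i)).
  by apply: eq_bigr => b ba; rewrite !permM s'lo// s'hi.
have -> : stdJ K (s (hi a)) (s (lo a)) = - stdJ K (s (lo a)) (s (hi a)).
  by rewrite !mxE eq_sym; ring.
rewrite signrN mulNr mulNr mulrN opprK; apply.
  rewrite -ltnS; apply: leq_trans lt_c; rewrite ltnS.
  apply: proper_card; apply/properP; split.
    apply/fintype.subsetP => b; rewrite !inE permM.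
    have [->|ba] := eqVneq b a; first by rewrite tpermL (negbTE ohi).
    by rewrite s'lo.
  by exists a; rewrite !inE // permM tpermL.
move=> b; rewrite !permM; have [->|ba] := eqVneq b a.
  by rewrite tpermL tpermR hs.
by rewrite s'lo// s'hi.
Qed.

(** A permutation compatible with the pairing contributes 1 and any other contributes 0, so the sum
    is at least the term of the identity. *)
Lemma pf_stdJ (K : numDomainType) : pf (stdJ K) != 0.
Proof.
suff : 1 <= pf (stdJ K).
  by move=> h; rewrite gt_eqF // (lt_le_trans ltr01).
rewrite /pf (bigD1 (1 : 'S_m)%g) //= pf_stdJ_term; last first.
  by move=> a; rewrite !perm1 hf_lo hf_hi.
rewrite lerDl; apply: sumr_ge0 => s _.
have [/forallP h|/forallPn[a na]] := boolP [forall a, hf (s (lo a)) == hf (s (hi a))].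
  by rewrite pf_stdJ_term ?ler01 // => a; apply/eqP.
by rewrite (bigD1 a) //= mxE (negbTE na) !mul0r mulr0.
Qed.

End Pairs.

(** * First-order variation of the determinant at the identity *)

Section DetDerivative.
Context {K : comNzRingType}.

Lemma perm_neq1 n (s : 'S_n) : s != 1%g ->
  exists i j, [/\ i != j, s i != i & s j != j].
Proof.
move=> s1; have [i si] : exists i, s i != i.
  apply/existsP; apply: contraR s1 => /existsPn h; apply/eqP/permP => i.
  by rewrite perm1; apply/eqP; rewrite -[_ == _]negbK h.
exists i, (s i); split=> //; first by rewrite eq_sym.
by apply: contra si => /eqP/perm_inj ->.
Qed.

(** A permutation other than 1 moves two indices, so its term is divisible by X^2; only the diagonal
    product contributes. *)
Lemma deriv_det n (B : 'M[K]_n) :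
  (\det (1%:M + 'X *: map_mx polyC B))^`().[0] = \tr B.
Proof.
have E i j : (1%:M + 'X *: map_mx polyC B) i j = (i == j)%:R + 'X * (B i j)%:P.
  by rewrite !mxE.
have d0 p : ((p : {poly K}) * 'X)^`().[0] = p.[0].
  by rewrite derivM derivX !hornerE.
rewrite /determinant (bigD1 (1%g : 'S_n)) //= odd_perm1 mul1r derivD hornerD.
rewrite [X in _ + X](_ : _ = 0) ?addr0.
  (* Polynomials with value 1 at 0 are closed under product, and their derivatives at 0 add up. *)
  pose r (p : {poly K}) (x : K) := p.[0] = 1 /\ p^`().[0] = x.
  suff [] : r (\prod_i (1%:M + 'X *: map_mx polyC B) i ((1 : 'S_n)%g i)) (\tr B) by [].
  rewrite /mxtrace; apply: (big_ind2 r) => [|p x q y [p0 px] [q0 qx]|i _].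
  - by split; rewrite ?derivC !hornerE.
  - by split; rewrite ?derivM !hornerE ?px ?qx p0 q0 !(mulr1, mul1r).
  rewrite perm1 E eqxx; split; first by rewrite !hornerE ?mul0r ?addr0.
  by rewrite ['X * _]mulrC derivD hornerD d0 -[1%:R]/(1%:P) derivC !hornerE.
rewrite (big_morph (fun p : {poly K} => p^`().[0]) (id1 := 0) (op1 := +%R)); first last.
- by rewrite derivC horner0.
- by move=> p q; rewrite derivD hornerD.
apply: big1 => s /perm_neq1[i [j [ij si sj]]].
rewrite (bigD1 i) //= (bigD1 j) 1?eq_sym //= !E.
rewrite ![(_ == s _)]eq_sym (negbTE si) (negbTE sj) !add0r.
set r := \prod_(_ | _) _; set c := _ ^+ _.
have -> : c * ('X * (B i (s i))%:P * ('X * (B j (s j))%:P * r)) =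
   (c * (B i (s i))%:P * (B j (s j))%:P * r * 'X) * 'X by ring.
by rewrite d0 hornerM hornerX mulr0.
Qed.

(** Away from column i the matrix is the identity, and a permutation other than 1 moves some index
    different from i, which makes its term vanish. *)
Lemma det_replace_col n (B : 'M[K]_n) i :
  \det (\matrix_(k, j) if j == i then B k i else (k == j)%:R) = B i i.
Proof.
rewrite -det_tr /determinant (bigD1 (1%g : 'S_n)) //= odd_perm1 mul1r.
rewrite [X in _ + X]big1 ?addr0 => [|s /perm_neq1[k [j [kj sk sj]]]].
  rewrite (bigD1 i) //= big1 ?mulr1 ?perm1 ?mxE ?eqxx // => j ji.
  by rewrite !mxE (negbTE ji) perm1 eqxx.
have [l li sl] : exists2 l, l != i & s l != l.
  by have [ki|] := eqVneq k i; [exists j; rewrite // -ki eq_sym|exists k].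
by rewrite (bigD1 l) //= !mxE (negbTE li) (negbTE sl) mul0r mulr0.
Qed.

End DetDerivative.

(** * Volume-preserving connections *)

Section FormTop.
Context {R : realType} {m k : nat} (e : m = k.*2).

Lemma form_topE (b : 'M[R]_m) (v : 'I_m -> 'cV[R]_m) :
  form_top b v = (2 ^+ m./2)^-1 * pf e (\matrix_(i, j) form b (v i) (v j)).
Proof.
rewrite /form_top; congr (_ * _); apply: eq_bigr => s _; congr (_ * _).
rewrite (prod_pairs e (fun i j => form b (v (s i)) (v (s j)))).
by apply: eq_bigr => a _; rewrite mxE.
Qed.

Lemma gram_mulmx (b V : 'M[R]_m) :
  \matrix_(i, j) form b (col i V) (col j V) = V^T *m b *m V.
Proof.
by apply/matrixP => i j; rewrite mxE /form tr_col -row_mul colE mulmxA -colE -row_mul 2!mxE.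
Qed.

End FormTop.

Section PfDerivative.
Context {R : realType} {m : nat} {M : smoothManifold R m}.
Variables (x : M) (v : 'cV[R]_m).

(** The polynomial p carries the first-order Taylor data of f at x along v. Sums and products are
    respected, so a Pfaffian sum of functions can be differentiated as one over polynomials, where
    [pf_mul] applies. *)
Definition jet (f : M -> R) (p : {poly R}) : Prop :=
  [/\ diff_at x f, f x = p.[0] & dir x v f = p^`().[0]].

Lemma jet_cst a : jet (fun=> a) a%:P.
Proof.
split; [exact: differentiable_cst|by rewrite hornerC|].
by rewrite dir_cst derivC horner0.
Qed.

Lemma jetD f g p q : jet f p -> jet g q -> jet (fun z => f z + g z) (p + q).
Proof.
move=> [df f0 f1] [dg g0 g1]; have [dfg E] := dirD v df dg.
by split=> //; rewrite ?E ?derivD hornerD ?f0 ?g0 ?f1 ?g1.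
Qed.

Lemma jetM f g p q : jet f p -> jet g q -> jet (fun z => f z * g z) (p * q).
Proof.
move=> [df f0 f1] [dg g0 g1]; have [dfg E] := dirM v df dg.
split=> //; first by rewrite hornerM f0 g0.
by rewrite E derivM hornerD !hornerM f0 g0 f1 g1; ring.
Qed.

Lemma jet_sum (I : Type) (r : seq I) (f : I -> M -> R) (p : I -> {poly R}) :
  (forall i, jet (f i) (p i)) ->
  jet (fun z => \sum_(i <- r) f i z) (\sum_(i <- r) p i).
Proof.
move=> h; elim: r => [|i r IH].
  rewrite big_nil (_ : (fun _ => _) = (fun=> 0)); first exact: jet_cst.
  by apply/funext => z; rewrite big_nil.
rewrite big_cons (_ : (fun _ => _) = (fun z => f i z + \sum_(i <- r) f i z)).
  exact: jetD.
by apply/funext => z; rewrite big_cons.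
Qed.

Lemma jet_prod (I : Type) (r : seq I) (f : I -> M -> R) (p : I -> {poly R}) :
  (forall i, jet (f i) (p i)) ->
  jet (fun z => \prod_(i <- r) f i z) (\prod_(i <- r) p i).
Proof.
move=> h; elim: r => [|i r IH].
  rewrite big_nil (_ : (fun _ => _) = (fun=> 1)); first exact: jet_cst.
  by apply/funext => z; rewrite big_nil.
rewrite big_cons (_ : (fun _ => _) = (fun z => f i z * \prod_(i <- r) f i z)).
  exact: jetM.
by apply/funext => z; rewrite big_cons.
Qed.

Lemma jet_pf k (e : m = k.*2) (F : M -> 'M[R]_m) (P : 'M[{poly R}]_m) :
  (forall i j, jet (fun z => F z i j) (P i j)) ->
  jet (fun z => pf e (F z)) (pf e P).
Proof.
move=> h; apply: jet_sum => s; apply: jetM; last by apply: jet_prod.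
by have := jet_cst ((-1) ^+ s); rewrite rmorphXn rmorphN1.
Qed.

End PfDerivative.

Section TraceFree.
Context {R : realType} {m : nat} {M : smoothManifold R m}.
Variables (Q : M -> set 'M[R]_m) (omega : M -> 'M[R]_m).
Hypothesis hQ : almost_quaternionic_skew_hermitian Q omega.
Variables (D0 : covder M) (A : M -> 'cV[R]_m -> 'cV[R]_m -> 'cV[R]_m).
Hypothesis hvol : preserves_vol D0 omega.
Hypothesis hA : forall x v Y Z, smooth_vf_near x Y -> smooth_vf_near x Z ->
  form (omega x) (A x v (Y x)) (Z x) = 2^-1 * nabla_form D0 omega x v Y Z.

(* To first order in the direction v, the Gram matrix of a frame is
   W^T omega W with W = 1 + tB, where B is the matrix of D0 + A; so pf varies by
   the trace of B, whereas volume preservation says that it varies by that of D0. *)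
Lemma A_tracefree k (e : m = k.*2) x v : pf e (omega x) != 0 ->
  \sum_i A x v (delta_mx i 0) i 0 = 0.
Proof.
move=> pf0; pose Y i : @vfield R m M := const_vf (chart_at x) (delta_mx i 0).
have sY i : smooth_vf_near x (Y i) by exact: smooth_near_const.
have Yx i : Y i x = delta_mx i 0 by exact: const_vfE.
pose Dm : 'M[R]_m := \matrix_(l, i) D0 x v (Y i) l 0.
pose Am : 'M[R]_m := \matrix_(l, i) A x v (delta_mx i 0) l 0.
pose B := Dm + Am.
have colB i : col i B = D0 x v (Y i) + A x v (delta_mx i 0).
  by apply/colP => l; rewrite !mxE.
pose W : 'M[{poly R}]_m := 1%:M + 'X *: map_mx polyC B.
pose P := W^T *m map_mx polyC (omega x) *m W.
pose F z : 'M[R]_m := \matrix_(i, j) form (omega z) (Y i z) (Y j z).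
have gram (C : 'M[R]_m) i j : (C^T *m omega x + omega x *m C) i j =
    form (omega x) (col i C) (delta_mx j 0) + form (omega x) (delta_mx i 0) (col j C).
  rewrite mxE; congr (_ + _).
    by rewrite /form tr_col -row_mul -colE !mxE; apply: eq_bigr => l _; rewrite !mxE.
  by rewrite /form trmx_delta -rowE colE mulmxA -colE -row_mul [RHS]mxE [RHS]mxE.
have jF i j : jet x v (fun z => F z i j) (P i j).
  pose E := (map_mx polyC B)^T *m map_mx polyC (omega x) *m map_mx polyC B.
  have PE : P i j = (omega x i j)%:P
      + ((B^T *m omega x + omega x *m B) i j)%:P * 'X + E i j * 'X * 'X.
    have WT : W^T = 1%:M + 'X *: (map_mx polyC B)^T.
      by apply/matrixP => a b; rewrite !mxE eq_sym.
    clearbody B; rewrite /P WT /W !(mulmxDl, mulmxDr) !mul1mx !mulmx1.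
    rewrite -!scalemxAl -!scalemxAr -/E.
    rewrite map_trmx -!map_mxM; clearbody E; rewrite !mxE /= polyCD.
    by ring.
  have dF : diff_at x (fun z => F z i j).
    rewrite (_ : (fun z => F z i j) = (fun z => form (omega z) (Y i z) (Y j z))).
      exact: (form_diff_at hQ).
    by apply/funext => z; rewrite mxE.
  split=> //.
    rewrite PE !hornerE mxE !Yx /form trmx_delta -rowE -colE !mxE.
    by rewrite ?mulr0 ?addr0.
  rewrite PE !derivD !derivM !derivC !derivX !hornerE ?mulr0 ?addr0 gram !colB.
  have -> : dir x v (fun z => F z i j) =
      dir x v (fun z => form (omega z) (Y i z) (Y j z)).
    by congr dir; apply/funext => z; rewrite mxE.
  have := hA v (sY i) (sY j); rewrite /nabla_form !Yx => hAij.
  have skA := A_skew hQ hA x v (delta_mx j 0) (delta_mx i 0).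
  have [_ [_ oT _ _]] := hQ.
  have sk a b : form (omega x) a b = - form (omega x) b a by exact: form_skew.
  (* By skewness the two [A]-terms of the Gram matrix are equal; with the factor 1/2 in [hA] they
     add up to the covariant derivative of [omega]. *)
  have h2 : form (omega x) (delta_mx i 0) (A x v (delta_mx j 0)) =
      form (omega x) (A x v (delta_mx i 0)) (delta_mx j 0).
    by rewrite sk skA opprK.
  rewrite /= !addr0 !formDl !formDr h2; move: hAij; lra.
have [_ _ jpf] := jet_pf e jF.
have := hvol v sY.
(* Replacing the i-th frame vector by its derivative is the change of frame [Wi], of determinant
   [Dm i i]; the sum over i is therefore the trace of [Dm] times the volume. *)
under eq_bigr => i _.
  pose Wi : 'M[R]_m := \matrix_(l, j) if j == i then Dm l i else (l == j)%:R.
  rewrite (form_topE e).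
  rewrite (_ : \matrix_(_, _) _ = Wi^T *m omega x *m Wi); last first.
    rewrite -gram_mulmx; apply/matrixP => a b; rewrite !mxE; congr form.
      by apply/colP => l; rewrite !mxE; case: eqP => _ //; rewrite Yx mxE andbT.
    by apply/colP => l; rewrite !mxE; case: eqP => _ //; rewrite Yx mxE andbT.
  rewrite pf_mul det_replace_col.
  over.
set c := (2 ^+ _)^-1; have c0 : c != 0 by rewrite invr_neq0// expf_neq0// pnatr_eq0.
have -> : (fun z => form_top (omega z) (fun i => Y i z)) = (fun z => c * pf e (F z)).
  by apply/funext => z; rewrite (form_topE e).
have [dpf _ _] := jet_pf e jF.
rewrite (dirZ v c dpf).2 jpf pf_mul -mulr_sumr.
have -> : pf e (map_mx polyC (omega x)) = (pf e (omega x))%:P.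
  rewrite /pf rmorph_sum; apply: eq_bigr => s _.
  rewrite rmorphM rmorphXn rmorphN1 rmorph_prod; congr (_ * _).
  by apply: eq_bigr => a _; rewrite mxE.
rewrite deriv_mulC hornerM hornerC deriv_det -mulr_sumr.
move/(mulfI c0)/(mulfI pf0); rewrite /B /mxtrace.
under eq_bigr do rewrite mxE.
rewrite big_split /= => /eqP; rewrite -subr_eq0 addrAC subrr add0r => /eqP h; rewrite -[RHS]h.
by apply: eq_bigr => i _; rewrite mxE.
Qed.

End TraceFree.

(** * Contraction of tensors on [EH] *)

Local Open Scope complex_scope.

Section Contraction.
Context {K : comNzRingType} {N : nat}.
Local Notation mat := ('M[K]_(N, 2)).

(** Nesting this one-slot pairing replaces the sixfold sum of [eheval], so that linearity, exchange
    of slots and the action of Q are proved one slot at a time. *)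
Definition br (X : 'I_N -> 'I_2 -> K) (Z : mat) : K := \sum_a \sum_h X a h * Z a h.

Definition br2 (X : 'I_N -> 'I_N -> 'I_2 -> 'I_2 -> K) (Z W : mat) : K :=
  br (fun b k => br (fun c l => X b c k l) W) Z.

Lemma sumI2 (V : nmodType) (F : 'I_2 -> V) : \sum_h F h = F 0 + F 1.
Proof. by rewrite !big_ord_recl big_ord0 addr0; congr (_ + F _); apply: val_inj. Qed.

Lemma brD X Y Z : br (fun a h => X a h + Y a h) Z = br X Z + br Y Z.
Proof.
rewrite -big_split; apply: eq_bigr => a _; rewrite -big_split.
by apply: eq_bigr => h _; rewrite mulrDl.
Qed.

Lemma brZ t X Z : br (fun a h => t * X a h) Z = t * br X Z.
Proof.
rewrite mulr_sumr; apply: eq_bigr => a _; rewrite mulr_sumr.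
by apply: eq_bigr => h _; rewrite mulrA.
Qed.

Lemma brN X Z : br (fun a h => - X a h) Z = - br X Z.
Proof. by rewrite -mulN1r -brZ; congr br; do 2!apply/funext => ?; rewrite mulN1r. Qed.

Lemma br_sum (I : Type) (r : seq I) (X : I -> 'I_N -> 'I_2 -> K) Z :
  br (fun a h => \sum_(i <- r) X i a h) Z = \sum_(i <- r) br (X i) Z.
Proof.
elim: r => [|i r IH].
  rewrite big_nil; apply: big1 => a _; apply: big1 => h _.
  by rewrite big_nil mul0r.
rewrite big_cons -IH -brD; congr br; do 2!apply/funext => ?.
by rewrite big_cons.
Qed.

Lemma br_lin X t Z W : br X (t *: Z + W) = t * br X Z + br X W.
Proof.
rewrite mulr_sumr -big_split; apply: eq_bigr => a _.
rewrite mulr_sumr -big_split; apply: eq_bigr => h _ /=.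
by rewrite !mxE; ring.
Qed.

Lemma br_exchange (X : 'I_N -> 'I_N -> 'I_2 -> 'I_2 -> K) Z W :
  br (fun b k => br (fun c l => X b c k l) W) Z =
  br (fun c l => br (fun b k => X b c k l) Z) W.
Proof.
rewrite /br; under eq_bigr => b _ do under eq_bigr => k _ do rewrite mulr_suml.
under eq_bigr => b _ do rewrite exchange_big /=.
rewrite exchange_big /=; apply: eq_bigr => c _.
under eq_bigr => b _ do under eq_bigr => k _ do
  (under eq_bigr => l _ do []; rewrite mulr_suml).
under eq_bigr => b _ do rewrite exchange_big /=.
rewrite exchange_big /=; apply: eq_bigr => l _; rewrite mulr_suml.
apply: eq_bigr => b _; rewrite mulr_suml; apply: eq_bigr => k _.
by rewrite mulrAC.
Qed.

Lemma br_mulmx X (q : 'M[K]_2) Z :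
  br X (Z *m q^T) = br (fun a h => \sum_k X a k * q k h) Z.
Proof.
apply: eq_bigr => a _.
under eq_bigr => h _ do rewrite mxE mulr_sumr.
rewrite exchange_big; apply: eq_bigr => h _ /=; rewrite mulr_suml.
by apply: eq_bigr => k _; rewrite !mxE; ring.
Qed.

Lemma br_delta X a h : br X (delta_mx a h) = X a h.
Proof.
rewrite /br (bigD1 a) //= (bigD1 h) //= mxE !eqxx mulr1 !big1 ?addr0 //.
  move=> b ba; apply: big1 => k _; rewrite mxE (negbTE ba) mulr0 //.
by move=> k kh; rewrite mxE (negbTE kh) andbF mulr0.
Qed.

End Contraction.

Section EhEval.
Context {R : realType} {n : nat}.
Local Notation C := R[i].
Local Notation N := (n + n)%N.
Local Notation mat := ('M[C]_(N, 2)).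

Lemma ehevalE (F : @ehtensor R n) Z1 Z2 Z3 : eheval F Z1 Z2 Z3 =
  br (fun a h => br2 (fun b c k l => F a b c h k l) Z2 Z3) Z1.
Proof.
apply: eq_bigr => a _.
transitivity (\sum_(b < N) \sum_(h < 2) \sum_(c < N) \sum_(k < 2) \sum_(l < 2)
    F a b c h k l * Z1 a h * Z2 b k * Z3 c l).
  by apply: eq_bigr => b _; rewrite exchange_big.
rewrite exchange_big; apply: eq_bigr => h _ /=; rewrite mulr_suml.
apply: eq_bigr => b _; rewrite exchange_big mulr_suml /=.
apply: eq_bigr => k _; rewrite !mulr_suml; apply: eq_bigr => c _.
rewrite !mulr_suml; apply: eq_bigr => l _; ring.
Qed.

Lemma br2_exchange (X : 'I_N -> 'I_N -> 'I_2 -> 'I_2 -> C) Z W :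
  br2 X Z W = br2 (fun b c k l => X c b l k) W Z.
Proof. exact: br_exchange. Qed.

Lemma eheval_swap12 (F : @ehtensor R n) Z1 Z2 Z3 :
  eheval F Z1 Z2 Z3 = eheval (fun a b c h k l => F b a c k h l) Z2 Z1 Z3.
Proof. by rewrite !ehevalE /br2 br_exchange. Qed.

Lemma ehevalD (F G : @ehtensor R n) Z1 Z2 Z3 :
  eheval (fun a b c h k l => F a b c h k l + G a b c h k l) Z1 Z2 Z3
  = eheval F Z1 Z2 Z3 + eheval G Z1 Z2 Z3.
Proof.
rewrite !ehevalE /br2 -brD; congr br; do 2!apply/funext => ?.
rewrite -brD; congr br; do 2!apply/funext => ?; exact: brD.
Qed.

Lemma ehevalN (F : @ehtensor R n) Z1 Z2 Z3 :
  eheval (fun a b c h k l => - F a b c h k l) Z1 Z2 Z3 = - eheval F Z1 Z2 Z3.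
Proof.
rewrite !ehevalE /br2 -brN; congr br; do 2!apply/funext => ?.
rewrite -brN; congr br; do 2!apply/funext => ?; exact: brN.
Qed.

Lemma sH00 : (sH : 'M[C]_2) 0 0 = 0. Proof. by rewrite mxE /= subrr. Qed.
Lemma sH11 : (sH : 'M[C]_2) 1 1 = 0. Proof. by rewrite mxE /= subrr. Qed.
Lemma sH01 : (sH : 'M[C]_2) 0 1 = 1. Proof. by rewrite mxE /= subr0. Qed.
Lemma sH10 : (sH : 'M[C]_2) 1 0 = -1. Proof. by rewrite mxE /= sub0r. Qed.
Definition sHE := (sH00, sH11, sH01, sH10).

Lemma ord2P (P : 'I_2 -> Prop) : P 0 -> P 1 -> forall h, P h.
Proof.
move=> P0 P1 [[|[|//]] lt]; [move: P0|move: P1];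
  by congr P; apply: val_inj.
Qed.

Lemma gsE (Z W : mat) : gs Z W = br2 (fun b c k l => (b == c)%:R * sH k l) Z W.
Proof.
apply: eq_bigr => a _; apply: eq_bigr => h _; rewrite mulrC -brZ.
rewrite /br (bigD1 a) //= [X in _ + X]big1 ?addr0.
  by apply: eq_bigr => k _; rewrite eqxx mul1r.
by move=> b ba; apply: big1 => k _; rewrite eq_sym (negbTE ba) !(mul0r, mulr0).
Qed.

Lemma conjc_im (x : C) : conjc x = x -> exists r : R, x = r%:C.
Proof.
case: x => a b [/eqP]; rewrite eq_sym -addr_eq0 -mulr2n mulrn_eq0 /= => /eqP ->.
by exists a.
Qed.

(* Real elements satisfy conj (Z a h) = +/- Z (flipE a) (flipH h). *)
Definition flipE (a : 'I_N) : 'I_N :=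
  match fintype.split a with inl i => rshift n i | inr i => lshift n i end.
Definition sgnE (a : 'I_N) : C := if fintype.split a is inl _ then 1 else -1.
Definition flipH (h : 'I_2) : 'I_2 := if h == 0 then 1 else 0.
Definition sgnH (h : 'I_2) : C := if h == 0 then 1 else -1.

Lemma split_lshift (i : 'I_n) : fintype.split (lshift n i) = inl i.
Proof. exact: (unsplitK (inl i)). Qed.
Lemma split_rshift (i : 'I_n) : fintype.split (rshift n i) = inr i.
Proof. exact: (unsplitK (inr i)). Qed.

Lemma ordEP (P : 'I_N -> Prop) :
  (forall i, P (lshift n i)) -> (forall i, P (rshift n i)) -> forall a, P a.
Proof. by move=> Pl Pr a; rewrite -(splitK a); case: (fintype.split a). Qed.

Lemma flipEl i : flipE (lshift n i) = rshift n i.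
Proof. by rewrite /flipE split_lshift. Qed.
Lemma flipEr i : flipE (rshift n i) = lshift n i.
Proof. by rewrite /flipE split_rshift. Qed.
Lemma sgnEl i : sgnE (lshift n i) = 1. Proof. by rewrite /sgnE split_lshift. Qed.
Lemma sgnEr i : sgnE (rshift n i) = -1. Proof. by rewrite /sgnE split_rshift. Qed.

Lemma flipEK : involutive flipE.
Proof. by apply: ordEP => i; rewrite ?(flipEl, flipEr). Qed.
Lemma flipHK : involutive flipH.
Proof. exact: ord2P. Qed.
Lemma sgnE_sqr a : sgnE a * sgnE a = 1.
Proof. by move: a; apply: ordEP => i; rewrite ?(sgnEl, sgnEr) ?mulr1// mulrNN mulr1. Qed.
Lemma sgnH_sqr h : sgnH h * sgnH h = 1.
Proof. by rewrite /sgnH; case: ifP => _; rewrite ?mulr1// mulrNN mulr1. Qed.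
Lemma sgnE_flip a : sgnE (flipE a) = - sgnE a.
Proof. by move: a; apply: ordEP => i; rewrite ?(flipEl, flipEr, sgnEl, sgnEr) ?opprK. Qed.
Lemma conj_sgnE a : conjc (sgnE a) = sgnE a.
Proof. by rewrite /sgnE; case: fintype.split => _; rewrite ?rmorphN rmorph1. Qed.
Lemma conj_sgnH a : conjc (sgnH a) = sgnH a.
Proof. by rewrite /sgnH; case: ifP => _; rewrite ?rmorphN rmorph1. Qed.

Lemma real_formE (Z : mat) : (jE *m map_mx conjc Z *m sH^T = Z) <->
  forall a h, conjc (Z a h) = sgnE (flipE a) * sgnH (flipH h) * Z (flipE a) (flipH h).
Proof.
have E a h : (jE *m map_mx conjc Z *m sH^T) a h =
    sgnE a * sgnH h * conjc (Z (flipE a) (flipH h)).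
  have jEE b k : (jE *m map_mx conjc Z) b k = sgnE b * conjc (Z (flipE b) k).
    move: b; apply: ordEP => i; rewrite ?(flipEl, flipEr, sgnEl, sgnEr).
      rewrite mxE big_split_ord /= big1 ?add0r => [|j _].
        rewrite (bigD1 i) //= /jE block_mxEur !mxE eqxx big1 ?addr0 // => j ji.
        by rewrite block_mxEur mxE eq_sym (negbTE ji) mul0r.
      by rewrite /jE block_mxEul mxE mul0r.
    rewrite mxE big_split_ord /= [X in _ + X]big1 ?addr0 => [|j _].
      rewrite (bigD1 i) //= /jE block_mxEdl !mxE eqxx big1 ?addr0 // => j ji.
      by rewrite block_mxEdl !mxE eq_sym (negbTE ji) oppr0 mul0r.
    by rewrite /jE block_mxEdr mxE mul0r.
  rewrite mxE sumI2 !jEE !mxE; move: h; apply: ord2P.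
    by rewrite /sgnH /flipH /=; ring.
  by rewrite /sgnH /flipH /=; ring.
split=> [H a h|H].
  rewrite -[in RHS]H E flipEK flipHK.
  have := sgnE_sqr (flipE a); have := sgnH_sqr (flipH h).
  set s := sgnE _; set t := sgnH _ => tt ss.
  transitivity (s * s * (t * t) * (Z a h)^*%C); last by ring.
  by rewrite tt ss; ring.
apply/matrixP => a h; rewrite E H !flipEK !flipHK.
transitivity (sgnE a * sgnE a * (sgnH h * sgnH h) * Z a h); first by ring.
by rewrite sgnE_sqr sgnH_sqr; ring.
Qed.

End EhEval.

(** * Tensors on one tangent space in the components of an adapted isomorphism *)

Section Adapted.
Context {R : realType} {n : nat}.
Local Notation C := R[i].
Local Notation N := (n + n)%N.
Local Notation TV := 'cV[R]_(4 * n).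
Variables (Q : set 'M[R]_(4 * n)) (omega : 'M[R]_(4 * n)).
Variable theta : TV -> 'M[C]_(N, 2).
Hypothesis had : adapted Q omega theta.
Hypothesis omegaT : omega^T = - omega.
Hypothesis omegaU : omega \in unitmx.

Lemma theta_lin a v w : theta (a *: v + w) = a%:C *: theta v + theta w.
Proof. by case: had => H _ _ _; exact: H. Qed.

Lemma theta_form v w : (form omega v w)%:C = gs (theta v) (theta w).
Proof. by case: had. Qed.

Lemma theta_real v a h : conjc (theta v a h) =
  sgnE (flipE a) * sgnH (flipH h) * theta v (flipE a) (flipH h).
Proof.
apply: (real_formE (theta v)).1; case: had => _ [_ rE] _ _.
have : range theta (theta v) by exists v.
by rewrite rE.
Qed.

(* A matrix Z is X + iY with X = (Z + Z') / 2 and Y = (Z - Z') / 2i real. *)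
Lemma br_theta_eq0 X : (forall v, br X (theta v) = 0) -> forall a h, X a h = 0.
Proof.
move=> H; pose Z' (Z : 'M[C]_(N, 2)) : 'M[C]_(N, 2) :=
  \matrix_(a, h) (sgnE a * sgnH h * conjc (Z (flipE a) (flipH h))).
have H' Z : real_form Z -> br X Z = 0.
  by case: had => _ [_ <-] _ _ [v _ <-].
(* [Z'] is the image of Z under the real structure. The values c = 1 and c = i give that the sum and
   the difference of the pairings of X with Z and [Z'] vanish. *)
have Zr (Z : 'M[C]_(N, 2)) (c : C) : real_form (c *: Z + conjc c *: Z' Z).
  apply/real_formE => a h; rewrite !mxE !rmorphD !rmorphM /= !conjcK.
  rewrite conj_sgnE conj_sgnH !flipEK !flipHK.
  have := sgnE_sqr (flipE a); have := sgnH_sqr (flipH h).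
  have -> : sgnE a = - sgnE (flipE a) :> C by rewrite sgnE_flip opprK.
  have -> : sgnH h = - sgnH (flipH h) :> C.
    by move: h; apply: ord2P; rewrite /sgnH /flipH /= ?opprK.
  set s := sgnE _; set t := sgnH _ => tt ss.
  transitivity (s * s * (t * t) * (conjc c * (Z a h)^*%C)
    + s * t * (c * Z (flipE a) (flipH h))); last by ring.
  by rewrite ss tt; ring.
move=> a h; rewrite -[LHS]br_delta; set Z := delta_mx a h.
have brs (t : C) W : br X (t *: W) = t * br X W.
  rewrite mulr_sumr; apply: eq_bigr => b _; rewrite mulr_sumr.
  by apply: eq_bigr => k _; rewrite mxE; ring.
have i2 : ('i%C : C) * 'i%C = -1 by rewrite -expr2 sqr_i.
have ci : conjc ('i%C : C) = - 'i%C.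
  by apply/eqP; rewrite eq_complex /= oppr0 !eqxx.
have h1 := H' _ (Zr Z 1); have h2 := H' _ (Zr Z 'i%C).
move: h1 h2; rewrite rmorph1 ci !br_lin !brs; set z := br X Z; set z' := br X _.
rewrite !mul1r => h1 h2.
have h3 : z - z' = 0.
  have := congr1 (fun y => - 'i%C * y) h2; rewrite mulr0 => <-.
  transitivity (- ('i%C * 'i%C) * (z - z')); last by ring.
  by rewrite i2 opprK mul1r.
have : 2%:R * z = (z + z') + (z - z') by ring.
by rewrite h1 h3 addr0 => /eqP; rewrite mulf_eq0 pnatr_eq0 /= => /eqP.
Qed.

Lemma br2_theta_eq0 X : (forall v w, br2 X (theta v) (theta w) = 0) ->
  forall b c k l, X b c k l = 0.
Proof.
move=> H b c k l; apply: (br_theta_eq0 (X := fun c l => X b c k l)) => w.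
by apply: (br_theta_eq0 (X := fun b k => br (fun c l => X b c k l) (theta w))) => v; exact: H.
Qed.

Lemma eheval_theta_eq0 (F : @ehtensor R n) :
  (forall u v w, eheval F (theta u) (theta v) (theta w) = 0) ->
  forall a b c h k l, F a b c h k l = 0.
Proof.
move=> H a b c h k l; apply: (br2_theta_eq0 (X := fun b c k l => F a b c h k l)) => v w.
apply: (br_theta_eq0 (X := fun a h => br2 (fun b c k l => F a b c h k l) (theta v) (theta w))) => u.
by rewrite -ehevalE.
Qed.

Definition dualv (i : 'I_(4 * n)) : TV := invmx omega *m delta_mx i 0.

Lemma form_dualv u i : form omega u (dualv i) = u i 0.
Proof. by rewrite /form /dualv mulmxA mulmxK// -colE !mxE. Qed.

(** The covector on E (x) H whose pairing with [theta u] is the i-th coordinate of u, obtained by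
    lowering the [omega]-dual basis vector. *)
Definition kap (i : 'I_(4 * n)) (a : 'I_N) (h : 'I_2) : C :=
  \sum_k sH h k * theta (dualv i) a k.

Lemma gs_kap i (Z : 'M[C]_(N, 2)) : gs Z (theta (dualv i)) = br (kap i) Z.
Proof.
apply: eq_bigr => a _; apply: eq_bigr => h _; rewrite mulr_suml.
by apply: eq_bigr => k _; ring.
Qed.

Lemma coord_kap (u : TV) i : (u i 0)%:C = br (kap i) (theta u).
Proof. by rewrite -form_dualv theta_form gs_kap. Qed.

(** The covector representing a real-linear f. An explicit formula makes it linear in f, so that it
    can be iterated over several slots. *)
Definition rep (f : TV -> C) (a : 'I_N) (h : 'I_2) : C :=
  \sum_i f (delta_mx i 0) * kap i a h.

Lemma lin_sum (V : lmodType C) (f : TV -> V) :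
  (forall a u v, f (a *: u + v) = a%:C *: f u + f v) ->
  forall u, f u = \sum_i (u i 0)%:C *: f (delta_mx i 0).
Proof.
move=> fl u; have f0 : f 0 = 0.
  by have := fl (-1) 0 0; rewrite scaler0 addr0 rmorphN rmorph1 scaleN1r addNr.
rewrite [in LHS](cV_sum_delta u).
have : forall r : seq 'I_(4 * n), f (\sum_(i <- r) u i 0 *: delta_mx i 0) =
    \sum_(i <- r) (u i 0)%:C *: f (delta_mx i 0).
  by elim=> [|i r IH]; rewrite ?big_nil// !big_cons fl IH.
exact.
Qed.

Lemma repE f : (forall a u v, f (a *: u + v) = a%:C * f u + f v) ->
  forall u, f u = br (rep f) (theta u).
Proof.
move=> fl u; rewrite (lin_sum (V := C^o) fl) br_sum; apply: eq_bigr => i _.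
by rewrite brZ -coord_kap [LHS]mulrC.
Qed.

Lemma rep_lin t f g a h :
  rep (fun v => t * f v + g v) a h = t * rep f a h + rep g a h.
Proof.
by rewrite mulr_sumr -big_split; apply: eq_bigr => i _ /=; rewrite mulrDl mulrA.
Qed.

Definition rep2 (f : TV -> TV -> C) b c k l := rep (fun v => rep (f v) c l) b k.

Lemma rep2E f : (forall w a u v, f (a *: u + v) w = a%:C * f u w + f v w) ->
  (forall w a u v, f w (a *: u + v) = a%:C * f w u + f w v) ->
  forall v w, f v w = br2 (rep2 f) (theta v) (theta w).
Proof.
move=> fl fr v w; rewrite (repE (fr v) w) /br2 br_exchange.
congr br; do 2!apply/funext => ?; apply: repE => a u u'.
by rewrite -rep_lin; congr rep; apply/funext => w'; exact: fl.
Qed.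

(** The second form of the identity contracts u first: for fixed u it displays [B u] as a single
    endomorphism with a tensor in two slots, as the lemmas on the normalizer and commutant of Q
    expect. *)
Lemma lowered_exists B : bilin B ->
  exists G : @ehtensor R n, lowers_to omega theta B G /\
    forall u v w, (form omega (B u v) w)%:C =
      br2 (fun b c k l => br (fun a h => G a b c h k l) (theta u)) (theta v) (theta w).
Proof.
move=> [Bl Br]; pose phi u v w := (form omega (B u v) w)%:C.
have phi1 v w a u u' : phi (a *: u + u') v w = a%:C * phi u v w + phi u' v w.
  by rewrite /phi (Bl v) formDl formZl rmorphD rmorphM.
have phi2 u w a v v' : phi u (a *: v + v') w = a%:C * phi u v w + phi u v' w.
  by rewrite /phi (Br u) formDl formZl rmorphD rmorphM.
have phi3 u v a w w' : phi u v (a *: w + w') = a%:C * phi u v w + phi u v w'.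
  by rewrite /phi formDr formZr rmorphD rmorphM.
pose G : @ehtensor R n := fun a b c h k l => rep (fun u => rep2 (phi u) b c k l) a h.
have GE u v w : phi u v w =
    br2 (fun b c k l => br (fun a h => G a b c h k l) (theta u)) (theta v) (theta w).
  rewrite (rep2E (phi2 u) (phi3 u)); congr br2; do 4!apply/funext => ?.
  apply: repE => t u1 u2; rewrite /rep2 -rep_lin; congr rep; apply/funext => v'.
  by rewrite -rep_lin; congr rep; apply/funext => w'; exact: phi1.
exists G; split=> // u v w; rewrite -/(phi u v w) GE ehevalE.
rewrite /br2 [RHS]br_exchange; congr br; do 2!apply/funext => ?.
exact: br_exchange.
Qed.

(** The components of B in the real basis are the real numbers assumed to exist, raised by the
    inverse of [omega]. *)
Lemma bitensor_exists (F : @ehtensor R n) :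
  (forall u v w, exists r : R, eheval F (theta u) (theta v) (theta w) = r%:C) ->
  exists B, lowers_to omega theta B F.
Proof.
move=> /(_ _ _ _)/cid Fr.
pose L u v : 'rV[R]_(4 * n) := \row_j sval (Fr u v (delta_mx j 0)).
exists (fun u v => (L u v *m invmx omega)^T) => u v w.
rewrite /form trmxK mulmxKV// mxE rmorph_sum /= ehevalE.
rewrite [RHS](_ : _ = \sum_i (w i 0)%:C * eheval F (theta u) (theta v) (theta (delta_mx i 0))).
  apply: eq_bigr => i _; rewrite mxE rmorphM mulrC; congr (_ * _).
  by rewrite [RHS](svalP (Fr u v (delta_mx i 0))).
pose f w := br (fun a h => br2 (fun b c k l => F a b c h k l) (theta v) (theta w))
  (theta u).
have fl t w1 w2 : f (t *: w1 + w2) = t%:C * f w1 + f w2.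
  rewrite /f theta_lin /br2 -brZ -brD; congr br; do 2!apply/funext => ?.
  by rewrite -brZ -brD; congr br; do 2!apply/funext => ?; exact: br_lin.
rewrite -/(f w) (lin_sum (V := C^o) fl); apply: eq_bigr => i _.
by rewrite ehevalE.
Qed.

End Adapted.

(** * Normalizer and commutant of Q *)

Section Normalizer.
Context {R : realType} {n : nat}.
Local Notation C := R[i].
Local Notation N := (n + n)%N.
Local Notation TV := 'cV[R]_(4 * n).
Variables (Q : set 'M[R]_(4 * n)) (omega : 'M[R]_(4 * n)).
Variable theta : TV -> 'M[C]_(N, 2).
Hypothesis had : adapted Q omega theta.
Hypothesis omegaT : omega^T = - omega.
Hypothesis omegaU : omega \in unitmx.
Hypothesis Qskew : forall J v w, Q J -> form omega (J *m v) w = - form omega v (J *m w).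

(** Multiplication by q^T for q in su(2) preserves the real form, hence comes from a real
    endomorphism, which adaptedness puts in Q. *)
Lemma su2_lift q : su2 q ->
  exists2 J, Q J & forall v, theta (J *m v) = theta v *m q^T.
Proof.
move=> [qH qT]; have qE k h : conjc (q h k) = - q k h.
  by have := congr1 (fun Z : 'M[C]_2 => Z k h) qH; rewrite !mxE.
have q11 : q 1 1 = - q 0 0.
  by move: qT; rewrite /mxtrace sumI2 => /eqP; rewrite addrC addr_eq0 => /eqP.
have pre v : exists w, theta w = theta v *m q^T.
  have : real_form (theta v *m q^T).
    apply/real_formE => a h; rewrite !mxE !sumI2 !mxE.
    rewrite rmorphD !rmorphM /= !(theta_real had) !qE.
    by move: h; apply: ord2P; rewrite /flipH /sgnH /= q11; ring.
  by have [_ [_ <-] _ _] := had; move=> [w _ <-]; exists w.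
have [w wE] := choice pre.
pose J : 'M[R]_(4 * n) := \matrix_(i, j) w (delta_mx j 0) i 0.
have JE v : theta (J *m v) = theta v *m q^T.
  rewrite (lin_sum (theta_lin had) v) mulmx_suml.
  have -> : J *m v = \sum_i v i 0 *: w (delta_mx i 0).
    apply/colP => j; rewrite mxE summxE; apply: eq_bigr => i _.
    by rewrite !mxE mulrC.
  have : forall r : seq 'I_(4 * n), theta (\sum_(i <- r) v i 0 *: w (delta_mx i 0)) =
      \sum_(i <- r) (v i 0)%:C *: theta (delta_mx i 0) *m q^T.
    have t0 : theta 0 = 0.
      by have := theta_lin had (-1) 0 0; rewrite scaler0 addr0 rmorphN rmorph1 scaleN1r addNr.
    elim=> [|i r IH]; first by rewrite !big_nil.
    by rewrite !big_cons (theta_lin had) IH wE scalemxAl.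
  exact.
exists J => //; have [_ _ QE _] := had; apply/QE.
by exists q.
Qed.

Definition qD : 'M[C]_2 := \matrix_(h, k) ((h == k)%:R * (if h == 0 then 'i%C else - 'i%C)).

Lemma su2_qD : su2 qD.
Proof.
have ci : conjc ('i%C : C) = - 'i%C by apply/eqP; rewrite eq_complex /= oppr0 !eqxx.
split; last by rewrite /mxtrace sumI2 !mxE /=; ring.
have ciN : conjc (- 'i%C : C) = 'i%C by rewrite -[RHS]conjcK ci.
apply/matrixP => h k; rewrite !mxE rmorphM rmorph_nat eq_sym.
case: eqP => [->|_]; last by rewrite !mul0r oppr0.
by rewrite !mul1r; case: ifP => _; rewrite ?ci ?ciN ?opprK.
Qed.

Lemma su2_sH : su2 (sH : 'M[C]_2).
Proof.
split; last by rewrite /mxtrace sumI2 !sHE addr0.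
apply/matrixP => h k; by rewrite !mxE rmorphB !rmorph_nat; ring.
Qed.

(** Invariant bilinear forms on H are skew. Invariance under diag(i, -i) kills the diagonal entries,
    and under [sH] the symmetric off-diagonal part. *)
Lemma sl2_invariant (Y : 'I_2 -> 'I_2 -> C) :
  (forall q, su2 q -> forall k l, \sum_k' Y k' l * q k' k + \sum_l' Y k l' * q l' l = 0) ->
  forall k l, Y k l + Y l k = 0.
Proof.
move=> H; have i0 : (2%:R * 'i%C : C) != 0.
  by rewrite mulf_eq0 pnatr_eq0 /= eq_complex /= oner_eq0 andbF.
have Y0 : Y 0 0 = 0.
  have := H _ su2_qD 0 0; rewrite !sumI2 !mxE /= => h.
  by apply: (mulfI i0); rewrite mulr0 -[RHS]h; ring.
have Y1 : Y 1 1 = 0.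
  have := H _ su2_qD 1 1; rewrite !sumI2 !mxE /= => h.
  by apply: (mulfI i0); rewrite mulr0 -[RHS]oppr0 -[in RHS]h; ring.
have Y01 : Y 0 1 + Y 1 0 = 0.
  have := H _ su2_sH 0 0; rewrite !sumI2 !sHE => h.
  by rewrite -[RHS]oppr0 -[in RHS]h; ring.
apply: ord2P; apply: ord2P; rewrite ?Y0 ?Y1 ?addr0//.
by rewrite addrC.
Qed.

Lemma br2_mull X (q : 'M[C]_2) (Z W : 'M[C]_(N, 2)) :
  br2 X (Z *m q^T) W = br2 (fun b c k l => \sum_k' X b c k' l * q k' k) Z W.
Proof.
rewrite /br2 br_mulmx; congr br; do 2!apply/funext => ?.
rewrite br_sum; apply: eq_bigr => i _; rewrite mulrC -brZ; congr br.
by do 2!apply/funext => ?; rewrite mulrC.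
Qed.

Lemma br2_mulr X (q : 'M[C]_2) (Z W : 'M[C]_(N, 2)) :
  br2 X Z (W *m q^T) = br2 (fun b c k l => \sum_l' X b c k l' * q l' l) Z W.
Proof. by rewrite /br2; congr br; do 2!apply/funext => ?; exact: br_mulmx. Qed.

Lemma br2D X Y (Z W : 'M[C]_(N, 2)) :
  br2 (fun b c k l => X b c k l + Y b c k l) Z W = br2 X Z W + br2 Y Z W.
Proof. by rewrite -brD; congr br; do 2!apply/funext => ?; exact: brD. Qed.

Lemma br2N X (Z W : 'M[C]_(N, 2)) :
  br2 (fun b c k l => - X b c k l) Z W = - br2 X Z W.
Proof. by rewrite -brN; congr br; do 2!apply/funext => ?; exact: brN. Qed.

Section Endo.
Variables (E : TV -> TV) (X : 'I_N -> 'I_N -> 'I_2 -> 'I_2 -> C).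
Hypothesis EX : forall v w, (form omega (E v) w)%:C = br2 X (theta v) (theta w).

(** Since J is skew for [omega], the lowered commutator is the infinitesimal action of q on both
    H-slots of X. *)
Lemma endo_commutator q J (g : TV -> TV) : Q J ->
  (forall v, theta (J *m v) = theta v *m q^T) ->
  (forall v, E (J *m v) - J *m E v = g v) ->
  forall v w, (form omega (g v) w)%:C =
   br2 (fun b c k l => \sum_k' X b c k' l * q k' k + \sum_l' X b c k l' * q l' l)
     (theta v) (theta w).
Proof.
move=> QJ Jq Jg v w; rewrite -Jg formBl (Qskew _ _ QJ) opprK rmorphD /=.
by rewrite !EX !Jq br2_mull br2_mulr -br2D.
Qed.

(** Commutators with Q lie in Q, whose lowered elements are a delta in the E-slots times a tensor in
    H. So each [X b c] with b != c, and each difference [X b b] - [X c c], is su(2)-invariant and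
    therefore skew. The H-symmetric part of X is thus a delta times a fixed tensor: the
    sp(1)-component. *)
Lemma normalizer_sym :
  (forall J, Q J -> exists2 J', Q J' & forall v, E (J *m v) - J *m E v = J' *m v) ->
  forall b c k l, (b != c -> X b c k l + X b c l k = 0) /\
    X b b k l + X b b l k = X c c k l + X c c l k.
Proof.
move=> HN; have H q : su2 q -> exists m, forall b c k l,
    \sum_k' X b c k' l * q k' k + \sum_l' X b c k l' * q l' l = (b == c)%:R * m k l.
  move=> /su2_lift[J QJ Jq]; have [J' QJ' HJ'] := HN _ QJ.
  have [_ _ QE _] := had; have [q' sq' Jq'] := (QE J').1 QJ'.
  exists (fun k l => \sum_k' sH k' l * q' k' k) => b c k l.
  apply/eqP; rewrite -subr_eq0; apply/eqP; move: b c k l.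
  apply: (br2_theta_eq0 had) => v w.
  rewrite br2D br2N -(endo_commutator QJ Jq HJ') (theta_form had) gsE Jq' br2_mull.
  apply/eqP; rewrite subr_eq0; apply/eqP; congr br2.
  do 4!apply/funext => ?; rewrite mulr_sumr; apply: eq_bigr => i _; ring.
move=> b c k l; split=> [bc|].
  apply: (sl2_invariant (Y := X b c)) => q /H[m mE] k' l'.
  by rewrite mE (negbTE bc) mul0r.
apply/eqP; rewrite -subr_eq0; apply/eqP.
have -> : X b b k l + X b b l k - (X c c k l + X c c l k) =
   (X b b k l - X c c k l) + (X b b l k - X c c l k) by ring.
apply: (sl2_invariant (Y := fun k l => X b b k l - X c c k l)) => q /H[m mE] k' l'.
have := mE b b k' l'; have := mE c c k' l'; rewrite !eqxx => h1 h2.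
rewrite !sumI2; move: h1 h2; rewrite !sumI2 => h1 h2.
transitivity (true%:R * m k' l' - true%:R * m k' l'); last by rewrite subrr.
by rewrite -{1}h2 -h1; ring.
Qed.

Lemma commutant_skew : (forall J v, Q J -> E (J *m v) = J *m E v) ->
  forall b c k l, X b c k l + X b c l k = 0.
Proof.
move=> HC b c; apply: sl2_invariant => q /su2_lift[J QJ Jq].
have Jg v : E (J *m v) - J *m E v = 0 by rewrite HC// subrr.
move: b c; have H := endo_commutator QJ Jq Jg.
suff : forall b c k l, (\sum_k' X b c k' l * q k' k + \sum_l' X b c k l' * q l' l) = 0.
  by move=> h b c; exact: h.
apply: (br2_theta_eq0 had) => v w; rewrite -H.
by rewrite -(scale0r 0) formZl mul0r.
Qed.

End Endo.
End Normalizer.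

(** * Coboundaries in the S^3H-isotypic part of the torsion space *)

Section TorsionModules.
Context {R : realType} {n : nat}.
Local Notation C := R[i].
Local Notation N := (n + n)%N.
Local Notation TV := 'cV[R]_(4 * n).
Variables (Q : set 'M[R]_(4 * n)) (omega : 'M[R]_(4 * n)).
Variable theta : TV -> 'M[C]_(N, 2).
Hypothesis had : adapted Q omega theta.
Hypothesis omegaT : omega^T = - omega.
Hypothesis omegaU : omega \in unitmx.
Hypothesis Qskew : forall J v w, Q J -> form omega (J *m v) w = - form omega v (J *m w).

(** The trace over the last two E-slots vanishes on K by its trace condition and skewness in the
    first two slots, and on Lambda^3 E because each diagonal entry is zero. *)
Lemma X12_lowered T : X_sum [:: 1; 2]%N omega theta T ->
  exists F : @ehtensor R n, [/\ lowers_to omega theta T F,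
    (forall a b c, in_S3H (F a b c)) &
    (forall a h k l, \sum_b F a b b h k l = 0)].
Proof.
move=> [Ti [HX TE]].
have [F1 [P1 S1] L1] := HX 1%N isT; have [F2 [P2 S2] L2] := HX 2%N isT.
exists (fun a b c h k l => F1 a b c h k l + F2 a b c h k l); split.
- move=> u v w; rewrite TE big_cons big_seq1 formDl rmorphD /= L1 L2.
  by rewrite ehevalD.
- move=> a b c h k l; have [e1 e2] := S1 a b c h k l; have [e3 e4] := S2 a b c h k l.
  by split; [rewrite e1 e3|rewrite e2 e4].
move=> a h k l; have [sk _ tr] := P1 h k l; have [sk2 sk3] := P2 h k l.
rewrite big_split /= [X in _ + X]big1 ?addr0.
  under eq_bigr do rewrite sk.
  by rewrite sumrN tr oppr0.
move=> b _; have /eqP := sk3 a b b.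
by rewrite -addr_eq0 -mulr2n mulrn_eq0 /= => /eqP.
Qed.

Lemma mulrn_eq0C (x : C) m : (0 < m)%N -> x *+ m = 0 -> x = 0.
Proof. by case: m => // m _ /eqP; rewrite mulrn_eq0 /= => /eqP. Qed.

(* Summing over the permutations of h, k, l gives
   6 F a b c = (b == c) q a - (a == c) q b, and the trace over b = c then gives
   (2n - 1) q = 0. *)
Lemma S3H_coboundary_eq0 (F G : @ehtensor R n) (M : 'I_N -> htensor (R := R)) :
  (0 < n)%N ->
  (forall a b c, in_S3H (F a b c)) ->
  (forall a h k l, \sum_b F a b b h k l = 0) ->
  (forall a b c h k l, F a b c h k l = G a b c h k l - G b a c k h l) ->
  (forall a b c h k l, G a b c h k l + G a b c h l k = (b == c)%:R * M a h k l) ->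
  forall a b c h k l, F a b c h k l = 0.
Proof.
move=> n0 S3 tr FG GM.
have Msym a h k l : M a h k l = M a h l k.
  by have := GM a a a h k l; have := GM a a a h l k; rewrite eqxx !mul1r addrC => -> ->.
pose q a h k l := M a h k l + M a k l h + M a l h k.
have F6 a b c h k l : F a b c h k l *+ 6 = (b == c)%:R * q a h k l - (a == c)%:R * q b h k l.
  have [s1 s2] := S3 a b c h k l; have [s3 s4] := S3 a b c k h l.
  have [s5 s6] := S3 a b c h l k.
  have f1 : F a b c k h l = F a b c h k l by rewrite s1.
  have f2 : F a b c h l k = F a b c h k l by rewrite s2.
  have f3 : F a b c k l h = F a b c h k l by rewrite -s4 f1.
  have f4 : F a b c l h k = F a b c h k l by rewrite -s5 f2.
  have f5 : F a b c l k h = F a b c h k l.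
    by have [_ <-] := S3 a b c l h k; rewrite f4.
  have -> : F a b c h k l *+ 6 = F a b c h k l + F a b c h l k + F a b c k h l
      + F a b c k l h + F a b c l h k + F a b c l k h.
    by rewrite f1 f2 f3 f4 f5; ring.
  rewrite !FG.
  (* The twelve values of G pair up under exchange of the last two H-slots, and [GM] replaces each
     pair by a value of M. *)
  transitivity ((G a b c h k l + G a b c h l k) + (G a b c k l h + G a b c k h l)
     + (G a b c l h k + G a b c l k h) - ((G b a c h k l + G b a c h l k) +
     (G b a c k l h + G b a c k h l) + (G b a c l h k + G b a c l k h))); first by ring.
  by rewrite !GM /q; ring.
have q0 a h k l : q a h k l = 0.
  have : \sum_b (F a b b h k l *+ 6) = 0 by rewrite sumrMnl tr mul0rn.
  under eq_bigr do rewrite F6 eqxx mul1r.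
  rewrite sumrB sumr_const card_ord (bigD1 a) //= eqxx mul1r big1 ?addr0.
    move=> h0; apply: (@mulrn_eq0C _ (N.-1)); first by lia.
    rewrite -h0 -[X in _ - X]mulr1n -mulrnBr; last by lia.
    by rewrite subn1.
  by move=> b ba; rewrite eq_sym (negbTE ba) mul0r.
move=> a b c h k l; apply: (@mulrn_eq0C _ 6) => //.
by rewrite F6 !q0 !mulr0 subrr.
Qed.

(** Applied in both directions of the theorem: B is the difference of two connections preserving Q
    in one, and commutes with Q in the other. *)
Lemma normalizer_torsion B T : (0 < n)%N -> bilin B ->
  (forall u J, Q J -> exists2 J', Q J' &
     forall v, B u (J *m v) - J *m B u v = J' *m v) ->
  X_sum [:: 1; 2]%N omega theta T -> (forall u v, T u v = B u v - B v u) ->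
  forall u v, T u v = 0.
Proof.
move=> n0 bB NB /X12_lowered[F [LF S3 tr]] TB.
have [G [LG GE]] := lowered_exists had omegaU bB.
(* The sp(1)-component can be read off any diagonal entry; [i0] fixes one. *)
have i0 : 'I_N by exists 0%N; lia.
have GM a b c h k l : G a b c h k l + G a b c h l k =
    (b == c)%:R * (G a i0 i0 h k l + G a i0 i0 h l k).
  have [<-|bc] := eqVneq b c.
    rewrite mul1r; apply/eqP; rewrite -subr_eq0; apply/eqP.
    pose Z a h := G a b b h k l + G a b b h l k - (G a i0 i0 h k l + G a i0 i0 h l k).
    apply: (br_theta_eq0 had (X := Z)) => u; rewrite /Z !(brD, brN).
    have [_ H] := normalizer_sym had Qskew (GE u) (NB u) b i0 k l.
    by rewrite H subrr.
  rewrite mul0r; pose Z a h := G a b c h k l + G a b c h l k.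
  apply: (br_theta_eq0 had (X := Z)) => u; rewrite /Z brD.
  by have [H _] := normalizer_sym had Qskew (GE u) (NB u) b c k l; exact: H.
have FG a b c h k l : F a b c h k l = G a b c h k l - G b a c k h l.
  apply/eqP; rewrite -subr_eq0; apply/eqP; move: a b c h k l.
  apply: (eheval_theta_eq0 had) => u v w.
  rewrite ehevalD -LF ehevalN ehevalD ehevalN -LG -(eheval_swap12 G) -LG TB.
  by rewrite formBl rmorphB /= subrr.
have F0 := S3H_coboundary_eq0 n0 S3 tr FG GM.
move=> u v; apply: (form_nondeg omegaU) => w; apply: complexI; rewrite LF.
rewrite ehevalE; apply: big1 => a _; apply: big1 => h _.
rewrite /br2 (_ : br _ _ = 0) ?mul0r//.
by apply: big1 => b _; apply: big1 => k _; rewrite (_ : br _ _ = 0) ?mul0r//;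
  apply: big1 => c _; apply: big1 => l _; rewrite F0 mul0r.
Qed.

End TorsionModules.

(** * Decomposition of E (x) S^2_0 E *)

Section SymmetricTensors.
Context {R : realType} {n : nat}.
Hypothesis n0 : (0 < n)%N.
Local Notation C := R[i].
Local Notation N := (n + n)%N.
Local Notation etensor := (@etensor R n).
Implicit Types f g : etensor.

Lemma sum_delta (F : 'I_N -> C) a : \sum_b (a == b)%:R * F b = F a.
Proof.
rewrite (bigD1 a) //= eqxx mul1r big1 ?addr0// => b ba.
by rewrite eq_sym (negbTE ba) mul0r.
Qed.

Lemma sum_delta_sym (F : 'I_N -> C) a : \sum_b (b == a)%:R * F b = F a.
Proof. by rewrite -[RHS]sum_delta; apply: eq_bigr => b _; rewrite eq_sym. Qed.

Let nC0 : n%:R != 0 :> C. Proof. by rewrite pnatr_eq0 -lt0n. Qed.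

(** The copy of E in E (x) S^2_0 E; the coefficient 1/n is 2 / dim E, which cancels the trace over
    the last two slots. *)
Definition Etensor (e : 'I_N -> C) : etensor := fun a b c =>
  (a == b)%:R * e c + (a == c)%:R * e b - (n%:R)^-1 * (b == c)%:R * e a.

(** The factor by which the trace over the first two slots of [Etensor e] multiplies e; [partE]
    divides by it. *)
Definition trE : C := (n + n)%:R + 1 - (n%:R)^-1.

Lemma trE_neq0 : trE != 0.
Proof.
have : n%:R * trE != 0.
  have -> : n%:R * trE = (n * (n + n) + n)%:R - 1.
    by rewrite /trE mulrBr mulfV// mulrDr mulr1 -natrM -natrD.
  by rewrite subr_eq0 -[1]/(1%:R) eqr_nat; nia.
by rewrite mulf_eq0 => /norP[].
Qed.

Lemma Etensor_sym e a b c : Etensor e a b c = Etensor e a c b.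
Proof. by rewrite /Etensor [b == c]eq_sym; ring. Qed.

Lemma Etensor_tr23 e a : \sum_b Etensor e a b b = 0.
Proof.
rewrite sumrB big_split /= sum_delta -[X in _ - X]mulr_suml -mulr_sumr.
have -> : \sum_(b < N) (b == b)%:R = n%:R + n%:R :> C.
  by under eq_bigr do rewrite eqxx; rewrite sumr_const card_ord -natrD.
by rewrite mulrDr mulVf//; ring.
Qed.

Lemma Etensor_tr12 e c : \sum_a Etensor e a a c = trE * e c.
Proof.
rewrite sumrB big_split /= [X in _ + X - _]sum_delta_sym.
under eq_bigr do rewrite eqxx mul1r.
rewrite sumr_const card_ord.
under eq_bigr do rewrite -mulrA.
by rewrite -mulr_sumr sum_delta_sym -[e c *+ _]mulr_natl /trE; ring.
Qed.

Definition tr12 f (c : 'I_N) : C := \sum_a f a a c.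

Definition partE f : etensor := Etensor (fun c => trE^-1 * tr12 f c).
Definition rest f : etensor := fun a b c => f a b c - partE f a b c.
(** The average over cyclic permutations is already totally symmetric when [rest f] is symmetric in
    its last two slots. *)
Definition partS f : etensor := fun a b c =>
  3^-1 * (rest f a b c + rest f b c a + rest f c a b).
Definition partK f : etensor := fun a b c => rest f a b c - partS f a b c.

Lemma parts_sum f a b c : partK f a b c + (partE f a b c + partS f a b c) = f a b c.
Proof. by rewrite /partK /rest; ring. Qed.

Lemma partE_in f : in_Esym (partE f).
Proof. by exists (fun c => trE^-1 * tr12 f c). Qed.

Section Parts.
Variables (f : etensor) (fP : sym23_tracefree f).

Lemma rest_sym a b c : rest f a b c = rest f a c b.
Proof. by rewrite /rest fP.1 /partE Etensor_sym. Qed.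
Lemma rest_tr23 a : \sum_b rest f a b b = 0.
Proof. by rewrite sumrB fP.2 Etensor_tr23 subr0. Qed.
Lemma rest_tr12 c : \sum_a rest f a a c = 0.
Proof. by rewrite sumrB Etensor_tr12 mulrA mulfV ?trE_neq0// mul1r subrr. Qed.
Lemma rest_tr13 b : \sum_a rest f a b a = 0.
Proof. by rewrite -[RHS](rest_tr12 b); apply: eq_bigr => a _; exact: rest_sym. Qed.

Lemma partS_in : in_S30 (partS f).
Proof.
split; last first.
  move=> a b c; rewrite /partS (rest_sym b a c) (rest_sym a c b) (rest_sym c b a).
  by ring.
split=> [a b c|a].
  rewrite /partS (rest_sym a c b) (rest_sym c b a) (rest_sym b a c).
  by ring.
rewrite -mulr_sumr 2!big_split /= rest_tr23 rest_tr12 rest_tr13.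
by rewrite !addr0 mulr0.
Qed.

Lemma partK_in : in_Ksym (partK f).
Proof.
have [[Ss S0] Sp] := partS_in.
split.
- split=> [a b c|a]; first by rewrite /partK rest_sym Ss.
  by rewrite sumrB rest_tr23 S0 subrr.
- move=> a b c; rewrite /partK.
  have -> : partS f b c a = partS f a b c by rewrite /partS; ring.
  have -> : partS f c a b = partS f a b c by rewrite /partS; ring.
  rewrite /partS; set x := rest f a b c; set y := rest f b c a; set z := rest f c a b.
  have := mulVf (_ : 3%:R != 0 :> C); rewrite pnatr_eq0 => /(_ isT) h3.
  transitivity ((1 - 3^-1 * 3%:R) * (x + y + z)); first by ring.
  by rewrite h3 subrr mul0r.
- move=> c; rewrite sumrB rest_tr12 -mulr_sumr 2!big_split /=.
  by rewrite rest_tr12 rest_tr13 rest_tr23 !addr0 mulr0 subrr.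
Qed.

End Parts.

(** The real structure that the quaternionic structures of E and H induce on tensors of E (x) E (x)
    E (x) H. *)
Definition conjf (f : 'I_2 -> etensor) : 'I_2 -> etensor := fun h a b c =>
  conjc (f (flipH h) (flipE a) (flipE b) (flipE c)) *
  (sgnE a * sgnE b * sgnE c * sgnH h).

Implicit Types F : 'I_2 -> etensor.

Definition realf F := forall h a b c, conjf F h a b c = F h a b c.

Lemma conj_tr12 (f : 'I_2 -> etensor) h c : realf f ->
  conjc (tr12 (f (flipH h)) (flipE c)) * (sgnE c * sgnH h) = tr12 (f h) c.
Proof.
move=> rf; rewrite /tr12 rmorph_sum mulr_suml (reindex_inj (inv_inj flipEK)) /=.
apply: eq_bigr => a _; rewrite -(rf h a a c) /conjf.
by rewrite sgnE_sqr mul1r.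
Qed.

Lemma flipE_eq (a b : 'I_N) : (flipE a == flipE b) = (a == b).
Proof. exact: (inj_eq (inv_inj flipEK)). Qed.

Let cjD (x y : C) : conjc (x + y) = conjc x + conjc y. Proof. exact: rmorphD. Qed.
Let cjB (x y : C) : conjc (x - y) = conjc x - conjc y. Proof. exact: rmorphB. Qed.
Let cjM (x y : C) : conjc (x * y) = conjc x * conjc y. Proof. exact: rmorphM. Qed.
Let cjV (x : C) : conjc x^-1 = (conjc x)^-1. Proof. exact: conjc_inv. Qed.
Let cjn m : conjc (m%:R : C) = m%:R. Proof. exact: conjc_nat. Qed.
Let cj1 : conjc (1 : C) = 1. Proof. exact: conjc1. Qed.

Lemma conj_trE : conjc trE = trE.
Proof. by rewrite /trE cjB cjD cjV !cjn cj1. Qed.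

Lemma real_partE (f : 'I_2 -> etensor) : realf f -> realf (fun h => partE (f h)).
Proof.
move=> rf h a b c; pose e h (c : 'I_N) := trE^-1 * tr12 (f h) c.
have eE c' : conjc (e (flipH h) (flipE c')) * (sgnE c' * sgnH h) = e h c'.
  by rewrite /e cjM cjV conj_trE -mulrA conj_tr12.
rewrite /conjf /partE -/(e h) -/(e (flipH h)) /Etensor !flipE_eq.
clearbody e; rewrite cjB cjD !(cjM, cjV, cjn).
(* A delta identifies two E-indices, whose signs then multiply to 1: the form g is compatible with
   the real structure. *)
have H (x y : 'I_N) (s t : C) : (x == y)%:R * (s * (sgnE x * sgnE y * t)) = (x == y)%:R * (s * t).
  by have [->|_] := eqVneq x y; rewrite ?mul0r// sgnE_sqr mul1r.
transitivity ((a == b)%:R * (conjc (e (flipH h) (flipE c)) * (sgnE a * sgnE b * (sgnE c * sgnH h)))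
 + (a == c)%:R * (conjc (e (flipH h) (flipE b)) * (sgnE a * sgnE c * (sgnE b * sgnH h)))
 - n%:R^-1 * ((b == c)%:R * (conjc (e (flipH h) (flipE a)) * (sgnE b * sgnE c * (sgnE a * sgnH h))))).
  by ring.
by rewrite !H !eE mulrA.
Qed.

Lemma real_rest (f : 'I_2 -> etensor) : realf f -> realf (fun h => rest (f h)).
Proof.
move=> rf h a b c; rewrite [RHS]/rest -(rf h a b c) -(real_partE rf h a b c).
by rewrite /conjf [in LHS]/rest cjB mulrBl.
Qed.

Lemma real_partS (f : 'I_2 -> etensor) : realf f -> realf (fun h => partS (f h)).
Proof.
move=> /real_rest rf h a b c; rewrite [RHS]/partS.
rewrite -(rf h a b c) -(rf h b c a) -(rf h c a b) /conjf [in LHS]/partS.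
by rewrite cjM cjV cjn !cjD; ring.
Qed.

Lemma real_partK (f : 'I_2 -> etensor) : realf f -> realf (fun h => partK (f h)).
Proof.
move=> rf h a b c; rewrite [RHS]/partK -(real_rest rf h a b c) -(real_partS rf h a b c).
by rewrite /conjf [in LHS]/partK cjB mulrBl.
Qed.

End SymmetricTensors.

(** * Tensors with values in the commutant of Q and their three components *)

Section Decomposition.
Context {R : realType} {n : nat}.
Hypothesis n0 : (0 < n)%N.
Local Notation C := R[i].
Local Notation N := (n + n)%N.
Local Notation TV := 'cV[R]_(4 * n).
Variables (Q : set 'M[R]_(4 * n)) (omega : 'M[R]_(4 * n)).
Variable theta : TV -> 'M[C]_(N, 2).
Hypothesis had : adapted Q omega theta.
Hypothesis omegaT : omega^T = - omega.
Hypothesis omegaU : omega \in unitmx.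
Hypothesis Qskew : forall J v w, Q J -> form omega (J *m v) w = - form omega v (J *m w).

Definition tensH (f : 'I_2 -> @etensor R n) : @ehtensor R n :=
  fun a b c h k l => f h a b c * sH k l.

Lemma conj_br X v : conjc (br X (theta v)) =
  br (fun a h => conjc (X (flipE a) (flipH h)) * (sgnE a * sgnH h)) (theta v).
Proof.
rewrite rmorph_sum (reindex_inj (inv_inj flipEK)); apply: eq_bigr => a _.
rewrite rmorph_sum (reindex_inj (inv_inj flipHK)); apply: eq_bigr => h _ /=.
by rewrite rmorphM /= (theta_real had) !flipEK !flipHK; ring.
Qed.

Lemma conj_eheval F u v w :
  conjc (eheval F (theta u) (theta v) (theta w)) =
  eheval (fun a b c h k l =>
    conjc (F (flipE a) (flipE b) (flipE c) (flipH h) (flipH k) (flipH l)) *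
    ((sgnE c * sgnH l) * (sgnE b * sgnH k) * (sgnE a * sgnH h)))
    (theta u) (theta v) (theta w).
Proof.
have brZr (X : 'I_N -> 'I_2 -> C) (Z : 'M[C]_(N, 2)) t :
    br X Z * t = br (fun a h => X a h * t) Z.
  by rewrite mulrC -brZ; congr br; do 2!apply/funext => ?; rewrite mulrC.
rewrite !ehevalE conj_br; congr br; apply/funext => a; apply/funext => h.
rewrite /br2 conj_br brZr; congr br; apply/funext => b; apply/funext => k.
rewrite conj_br brZr brZr; congr br; apply/funext => c; apply/funext => l.
by rewrite !mulrA.
Qed.

Lemma sgnH_sH k l : conjc ((sH : 'M[C]_2) (flipH k) (flipH l)) * (sgnH k * sgnH l) = sH k l.
Proof.
have E k' l' : conjc ((sH : 'M[C]_2) k' l') = sH k' l'.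
  by rewrite !mxE rmorphB !rmorph_nat.
rewrite E; move: k l; apply: ord2P; apply: ord2P;
  by rewrite /flipH /sgnH /= !sHE; ring.
Qed.

(** Conjugating a value on real vectors amounts to applying [conjf], because [sH] is itself real;
    the converse holds because real vectors separate tensors. *)
Lemma realf_eheval f :
  realf f <-> forall u v w, exists r : R,
    eheval (tensH f) (theta u) (theta v) (theta w) = r%:C.
Proof.
have E u v w : conjc (eheval (tensH f) (theta u) (theta v) (theta w)) =
    eheval (tensH (conjf f)) (theta u) (theta v) (theta w).
  rewrite conj_eheval; congr eheval; do 3!apply/funext => ?.
  apply/funext => h; apply/funext => k; apply/funext => l.
  by rewrite /tensH /conjf -[in RHS](sgnH_sH k l) rmorphM /=; ring.
split=> [rf u v w|H].
  apply: conjc_im; rewrite E; congr eheval; do 6!apply/funext => ?.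
  by rewrite /tensH rf.
have H0 : forall a b c h k l, tensH (conjf f) a b c h k l - tensH f a b c h k l = 0.
  apply: (eheval_theta_eq0 had) => u v w; rewrite ehevalD ehevalN -E.
  by have [r ->] := H u v w; rewrite conjc_real subrr.
move=> h a b c; have := H0 a b c h 0 1; rewrite /tensH sHE !mulr1.
by move/eqP; rewrite subr_eq0 => /eqP.
Qed.

(** The images of the standard basis and the covectors [kap] are dual bases of E (x) H, so that a
    real trace can be computed as a complex one. *)
Lemma dual_theta b c k l :
  \sum_i theta (delta_mx i 0) b k * kap omega theta i c l
  = (b == c)%:R * (k == l)%:R.
Proof.
apply/eqP; rewrite -subr_eq0; apply/eqP; move: c l.
pose X c l := \sum_i theta (delta_mx i 0) b k * kap omega theta i c l -
   (b == c)%:R * (k == l)%:R.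
suff : forall u, br X (theta u) = 0 by move/(br_theta_eq0 had).
move=> u; rewrite /X brD brN br_sum.
have -> : br (fun c l => (b == c)%:R * (k == l)%:R) (theta u) = theta u b k.
  rewrite /br (bigD1 b) //= (bigD1 k) //= !eqxx !mul1r !big1 ?addr0 //.
    by move=> c cb; rewrite big1 // => l _; rewrite eq_sym (negbTE cb) !mul0r.
  by move=> l lk; rewrite eq_sym (negbTE lk) mulr0 mul0r.
apply/eqP; rewrite subr_eq0; apply/eqP.
rewrite [in RHS](lin_sum (theta_lin had) u) summxE; apply: eq_bigr => i _.
by rewrite brZ -(coord_kap had omegaU) mxE mulrC.
Qed.

Section LoweredEndo.
Variable A : TV -> TV -> TV.
Hypothesis bA : bilin A.
Hypothesis cA : forall v w J, Q J -> A v (J *m w) = J *m A v w.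
Hypothesis sA : forall v w u, form omega (A v w) u = - form omega (A v u) w.
Hypothesis tA : forall v, \sum_i A v (delta_mx i 0) i 0 = 0.

(** Commuting with Q makes the tensor skew in its last two H-slots, hence a multiple of [sH].
    Skewness for [omega] then becomes symmetry in the last two E-slots, and the trace over E is half
    the real trace. *)
Lemma commutant_lowered : exists f : 'I_2 -> @etensor R n,
  (forall h, sym23_tracefree (f h)) /\ lowers_to omega theta A (tensH f).
Proof.
have [G [LG GE]] := lowered_exists had omegaU bA.
have Gsk a b c h k l : G a b c h k l + G a b c h l k = 0.
  pose Z a h := G a b c h k l + G a b c h l k.
  apply: (br_theta_eq0 had (X := Z)) => u; rewrite /Z brD.
  by apply: (commutant_skew had Qskew (GE u)) => J v QJ; exact: cA.
have Gsym a b c h k l : G a b c h k l + G a c b h l k = 0.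
  pose Z a h := G a b c h k l + G a c b h l k.
  apply: (br_theta_eq0 had (X := Z)) => u; rewrite /Z brD.
  pose X b c k l := br (fun a h => G a b c h k l) (theta u)
    + br (fun a h => G a c b h l k) (theta u).
  apply: (br2_theta_eq0 had (X := X)) => v w; rewrite /X br2D.
  by rewrite [X in _ + X]br2_exchange -!GE -rmorphD sA /= addNr.
have GF a b c h k l : G a b c h k l = G a b c h 0 1 * sH k l.
  have sk0 k' : G a b c h k' k' = 0.
    by have /eqP := Gsk a b c h k' k'; rewrite -mulr2n mulrn_eq0 /= => /eqP.
  move: k l; apply: ord2P; apply: ord2P; rewrite sHE ?mulr0 ?mulr1 ?sk0//.
  by have /eqP := Gsk a b c h 1 0; rewrite addr_eq0 mulrN1 => /eqP.
exists (fun h a b c => G a b c h 0 1); split; last first.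
  move=> u v w; rewrite LG; congr eheval; do 6!apply/funext => ?; exact: GF.
move=> h; split=> [a b c|a].
  have := Gsym a b c h 0 1; rewrite (GF a c b h 1 0) sHE mulrN1 => /eqP.
  by rewrite subr_eq0 => /eqP.
move: a h; apply: (br_theta_eq0 had (X := fun a h => \sum_b G a b b h 0 1)) => u.
rewrite br_sum; pose g b c := br (fun a h => G a b c h 0 1) (theta u).
have gE v w : (form omega (A u v) w)%:C = br2 (fun b c k l => g b c * sH k l) (theta v) (theta w).
  rewrite GE; congr br2; do 4!apply/funext => ?.
  by rewrite /g mulrC -brZ; congr br; do 2!apply/funext => ?; rewrite GF mulrC.
have : \sum_i (A u (delta_mx i 0) i 0)%:C = 0 by rewrite -rmorph_sum /= tA.
under eq_bigr => i _.
  rewrite -(form_dualv omegaU) gE.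
  have -> : br2 (fun b c k l => g b c * sH k l) (theta (delta_mx i 0)) (theta (dualv omega i))
     = \sum_b \sum_k \sum_c g b c * (theta (delta_mx i 0) b k * kap omega theta i c k).
    apply: eq_bigr => b _; apply: eq_bigr => k _; rewrite /br mulr_suml.
    apply: eq_bigr => c _; rewrite /kap !mulr_sumr mulr_suml.
    by apply: eq_bigr => l _; ring.
  over.
rewrite exchange_big /= => h0.
(* The factor 2 is the dimension of H, over which the trace of the identity is taken. *)
have : 2%:R * \sum_b g b b = 0.
  rewrite -[RHS]h0 mulr_sumr; apply: eq_bigr => b _.
  rewrite exchange_big /=.
  under eq_bigr => k _.
    rewrite exchange_big /=.
    under eq_bigr => c _ do rewrite -mulr_sumr dual_theta eqxx mulr1 mulrC.
    rewrite sum_delta.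
    over.
  by rewrite sumr_const card_ord mulr_natl.
by move/eqP; rewrite mulf_eq0 pnatr_eq0 /= => /eqP.
Qed.

(** The decomposition of the complex tensor commutes with the real structure, so each component is
    the lowered form of a bitensor, and [delta] applies to each separately. *)
Lemma delta_X345 : X_sum [:: 3; 4; 5]%N omega theta (delta A).
Proof.
have [f [fP Lf]] := commutant_lowered.
have rf : realf f by apply/realf_eheval => u v w; rewrite -Lf; exists (form omega (A u v) w).
have ex g : realf g -> exists B, lowers_to omega theta B (tensH g).
  by move=> /realf_eheval; exact: (bitensor_exists had).
have [BK LK] := ex _ (real_partK rf).
have [BE LE] := ex _ (real_partE rf).
have [BS LS] := ex _ (real_partS rf).
have AE u v : A u v = BK u v + (BE u v + BS u v).
  apply: (form_inj omegaU) => w; apply: complexI; rewrite !formDl !rmorphD /=.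
  rewrite Lf LK LE LS -!ehevalD; congr eheval; do 6!apply/funext => ?.
  by rewrite /tensH -[in LHS](parts_sum (f _)) !mulrDl.
exists (fun i => match i with 3 => delta BK | 4 => delta BE | _ => delta BS end).
split=> [i|u v].
  rewrite !inE => /or3P[] /eqP ->.
  - exists BK, (tensH (fun h => partK (f h))); split=> //.
    by exists (fun h => partK (f h)); split=> // h; exact: partK_in.
  - exists BE, (tensH (fun h => partE (f h))); split=> //.
    by exists (fun h => partE (f h)); split=> // h; exact: partE_in.
  - exists BS, (tensH (fun h => partS (f h))); split=> //.
    by exists (fun h => partS (f h)); split=> // h; exact: partS_in.
rewrite !big_cons big_nil addr0 /delta !AE.
by apply/colP => j; rewrite !mxE; ring.
Qed.

End LoweredEndo.

Lemma eheval_lin1 F t (Z Z' Z2 Z3 : 'M[C]_(N, 2)) :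
  eheval F (t *: Z + Z') Z2 Z3 = t * eheval F Z Z2 Z3 + eheval F Z' Z2 Z3.
Proof. by rewrite !ehevalE br_lin. Qed.

Lemma eheval_lin2 F t (Z1 Z Z' Z3 : 'M[C]_(N, 2)) :
  eheval F Z1 (t *: Z + Z') Z3 = t * eheval F Z1 Z Z3 + eheval F Z1 Z' Z3.
Proof. by rewrite !(eheval_swap12 F) eheval_lin1. Qed.

Lemma tensH_bilin f B : lowers_to omega theta B (tensH f) -> bilin B.
Proof.
move=> L; split=> [w t u v|v t u w]; apply: (form_inj omegaU) => z; apply: complexI;
  by rewrite formDl formZl rmorphD rmorphM /= !L (theta_lin had) ?eheval_lin1 ?eheval_lin2.
Qed.

(** The form [sH] is annihilated by trace-free matrices acting on its two slots. *)
Lemma tensH_commutes f B : lowers_to omega theta B (tensH f) ->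
  forall v w J, Q J -> B v (J *m w) = J *m B v w.
Proof.
move=> L v w J QJ; have [_ _ QE _] := had; have [q [_ trq] Jq] := (QE J).1 QJ.
apply: (form_inj omegaU) => z; rewrite (Qskew _ _ QJ).
apply/eqP; rewrite -subr_eq0 opprK; apply/eqP; apply: complexI.
rewrite rmorphD /= !L !Jq !ehevalE -brD; apply: big1 => a _; apply: big1 => h _.
rewrite br2_mull br2_mulr -br2D; apply/eqP; rewrite mulf_eq0; apply/orP; left; apply/eqP.
apply: big1 => b _; apply: big1 => k _.
rewrite /br big1 ?mul0r// => c _; apply: big1 => l _.
apply/eqP; rewrite mulf_eq0; apply/orP; left; apply/eqP.
have q11 : q 1 1 = - q 0 0.
  by move: trq; rewrite /mxtrace sumI2 => /eqP; rewrite addrC addr_eq0 => /eqP.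
rewrite !sumI2 /tensH; move: k l; apply: ord2P; apply: ord2P;
  by rewrite !sHE ?q11; ring.
Qed.

Lemma X345_delta T : X_sum [:: 3; 4; 5]%N omega theta T ->
  exists B, [/\ bilin B, forall v w J, Q J -> B v (J *m w) = J *m B v w &
    forall u v, T u v = B u v - B v u].
Proof.
move=> [Ti [HX TE]].
have H P T' : delta_H P omega theta T' ->
    exists B, [/\ bilin B, forall v w J, Q J -> B v (J *m w) = J *m B v w &
    forall u v, T' u v = B u v - B v u].
  move=> [B [F [[f [_ FE]] L ->]]].
  have {}L : lowers_to omega theta B (tensH f).
    by move=> u v w; rewrite L; congr eheval; do 6!apply/funext => ?; exact: FE.
  by exists B; split; [exact: tensH_bilin L|exact: tensH_commutes L|].
have [B3 [[l3 r3] c3 d3]] := H _ _ (HX 3%N isT).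
have [B4 [[l4 r4] c4 d4]] := H _ _ (HX 4%N isT).
have [B5 [[l5 r5] c5 d5]] := H _ _ (HX 5%N isT).
exists (fun u v => B3 u v + B4 u v + B5 u v); split.
- split=> [w t u v|v t u w].
    have -> : B3 (t *: u + v) w = t *: B3 u w + B3 v w by exact: l3.
    have -> : B4 (t *: u + v) w = t *: B4 u w + B4 v w by exact: l4.
    have -> : B5 (t *: u + v) w = t *: B5 u w + B5 v w by exact: l5.
    by apply/colP => j; rewrite !mxE; ring.
  have -> : B3 v (t *: u + w) = t *: B3 v u + B3 v w by exact: r3.
  have -> : B4 v (t *: u + w) = t *: B4 v u + B4 v w by exact: r4.
  have -> : B5 v (t *: u + w) = t *: B5 v u + B5 v w by exact: r5.
  by apply/colP => j; rewrite !mxE; ring.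
- by move=> v w J QJ; rewrite c3// c4// c5// !mulmxDr.
move=> u v; rewrite TE !big_cons big_nil d3 d4 d5.
by apply/colP => j; rewrite !mxE; ring.
Qed.

End Decomposition.

(** * Nonvanishing of the Pfaffian sum of omega *)

Section PfAdapted.
Context {R : realType} {n : nat}.
Local Notation C := R[i].
Local Notation N := (n + n)%N.
Local Notation TV := 'cV[R]_(4 * n).
Variables (Q : set 'M[R]_(4 * n)) (omega : 'M[R]_(4 * n)).
Variable theta : TV -> 'M[C]_(N, 2).
Hypothesis had : adapted Q omega theta.
Hypothesis omegaU : omega \in unitmx.

(** Number the entries of E (x) H so that the E-index is the pair and the H-index the parity. In
    these coordinates g (x) s is the standard symplectic matrix, and the change of coordinates [Th]
    is invertible because [omega] is. *)
Lemma pf_adapted (e : (4 * n)%N = N.*2) : pf e omega != 0.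
Proof.
pose o (p : 'I_(4 * n)) : 'I_2 := if odd p then 1 else 0.
pose Th : 'M[C]_(4 * n) := \matrix_(p, i) theta (delta_mx i 0) (hf e p) (o p).
pose O : 'M[C]_(4 * n) := map_mx (real_complex R) omega.
have OE : O = Th^T *m stdJ e C *m Th.
  apply/matrixP => i j; rewrite mxE.
  have -> : omega i j = form omega (delta_mx i 0) (delta_mx j 0).
    by rewrite /form trmx_delta -rowE -colE !mxE.
  have JE p q : stdJ e C p q = (hf e p == hf e q)%:R * ((odd q)%:R - (odd p)%:R).
    by rewrite mxE.
  have lo0 a : o (lo e a) = 0 by rewrite /o lo_even.
  have hi1 a : o (hi e a) = 1 by rewrite /o hi_odd.
  have H c : (Th^T *m stdJ e C) i (lo e c) = - theta (delta_mx i 0) c 1 /\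
      (Th^T *m stdJ e C) i (hi e c) = theta (delta_mx i 0) c 0.
    rewrite !mxE !(big_lohi e); split.
      rewrite -[RHS](sum_delta_sym (fun a => - theta (delta_mx i 0) a 1)).
      apply: eq_bigr => a _.
      by rewrite !JE !mxE !hf_lo !hf_hi lo0 hi1 !lo_even !hi_odd /=; ring.
    rewrite -[RHS](sum_delta_sym (fun a => theta (delta_mx i 0) a 0)).
    apply: eq_bigr => a _.
    by rewrite !JE !mxE !hf_lo !hf_hi lo0 hi1 !lo_even !hi_odd /=; ring.
  rewrite (theta_form had) mxE (big_lohi e); apply: eq_bigr => c _ /=.
  rewrite (H c).1 (H c).2 [X in - _ * X]mxE [X in _ + _ * X]mxE lo0 hi1 hf_lo hf_hi.
  by rewrite !sumI2 !sHE; ring.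
have detO : \det O != 0.
  by rewrite det_map_mx fmorph_eq0 -unitfE -unitmxE.
have pfO : pf e O = (pf e omega)%:C.
  rewrite /pf rmorph_sum; apply: eq_bigr => s _.
  rewrite rmorphM rmorphXn rmorphN1 rmorph_prod; congr (_ * _).
  by apply: eq_bigr => a _; rewrite mxE.
rewrite -(fmorph_eq0 (real_complex R)) -[X in X != _]pfO OE pf_mul.
rewrite mulf_neq0 ?pf_stdJ//.
by apply: contraNneq detO => d0; rewrite OE det_mulmx d0 mulr0.
Qed.

End PfAdapted.

Theorem theorem1p3 (R : realType) (n : nat) (hn : (1 < n)%N)
    (M : smoothManifold R (4 * n)) (M_connected : connected [set: M]%classic)
    (Q : M -> set 'M[R]_(4 * n)) (omega : M -> 'M[R]_(4 * n))
    (hQomega : almost_quaternionic_skew_hermitian Q omega)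
    (D : covder M) (hD : canonical_connection Q omega D) :
  quaternionic Q <-> torsion_in Q omega [:: 3; 4; 5]%N D.
Proof.
have n0 : (0 < n)%N by exact: ltnW.
have e : (4 * n)%N = (n + n).*2 by lia.
have [aq [_ oT oU _]] := hQomega.
have [D0 [A [[[cD0 qD0 tD0] vD0] hA DA]]] := hD.
have Qsk x J v w : Q x J -> form (omega x) (J *m v) w = - form (omega x) v (J *m w).
  exact: Q_skew.
have Q0 x : Q x 0.
  have [U [J1 [J2 [J3 [_ Ux [_ _ _ H]]]]]] := aq x.
  by have [_ _ _ _ ->] := H x Ux; exists 0, 0, 0; rewrite !scale0r !addr0.
have bA x : bilin (A x).
  exact (A_bilin hQomega cD0 hA x).
have cA x v w J : Q x J -> A x v (J *m w) = J *m A x v w.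
  by move=> QJ; exact (A_commutes hQomega cD0 qD0 hA v w QJ).
have torD x T0 : is_torsion_at D0 x T0 ->
    is_torsion_at D x (fun v w => T0 v w + delta (A x) v w).
  move=> tT X Y sX sY; rewrite -(tT X Y sX sY) /torsion /delta !DA//.
  by apply/colP => j; rewrite !mxE; ring.
split=> [[D' [cD' qD' tD']] x|tD].
  have [theta [T0 [had tT0 X12]]] := tD0 x.
  exists theta, (delta (A x)); split=> //; last first.
    apply: (delta_X345 n0 had (oU x) (Qsk x) (bA x) (cA x)) => [v w u|v].
      exact (A_skew hQomega hA x v w u).
    exact (A_tracefree hQomega vD0 hA v (pf_adapted had (oU x) e)).
  (* The torsion of D0 is the coboundary of its difference S from the torsion-free connection, and S
     normalizes Q. *)
  have [S bS SE] := connection_diff x cD0 cD'.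
  have T0E v w : T0 v w = S v w - S w v.
    by rewrite -(torsion_diff SE tT0 (tD' x)) subr0.
  have T00 := normalizer_torsion had (oU x) (Qsk x) n0 bS
    (preserves_Q_diff aq qD0 qD' SE bS) X12 T0E.
  move=> X Y sX sY; rewrite (torD x T0 tT0 X Y sX sY) T00 add0r //.
(* The Oproiu connection itself is the torsion-free connection sought. *)
exists D0; split=> // x X Y sX sY.
have [theta [T0 [had tT0 X12]]] := tD0 x.
(* [theta'] may differ from [theta], but the B extracted through it is described without reference
   to either: it commutes with Q and T is its coboundary. *)
have [theta' [T [had' tT X345]]] := tD x.
have [B [[Bl Br] cB TB]] := X345_delta had' (oU x) (Qsk x) X345.
pose S v w := B v w - A x v w; have [Al Ar] := bA x.
have bS : bilin S.
  split=> [w t u v|v t u w]; rewrite /S.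
    have -> : B (t *: u + v) w = t *: B u w + B v w by exact: Bl.
    have -> : A x (t *: u + v) w = t *: A x u w + A x v w by exact: Al.
    by apply/colP => j; rewrite !mxE; ring.
  have -> : B v (t *: u + w) = t *: B v u + B v w by exact: Br.
  have -> : A x v (t *: u + w) = t *: A x v u + A x v w by exact: Ar.
  by apply/colP => j; rewrite !mxE; ring.
have T0E v w : T0 v w = S v w - S w v.
  pose K u : @vfield R _ M := const_vf (chart_at x) u.
  have sK u : smooth_vf_near x (K u) by exact: smooth_near_const.
  have Kx u : K u x = u by exact: const_vfE.
  have := tT _ _ (sK v) (sK w); rewrite (torD x T0 tT0 _ _ (sK v) (sK w)) !Kx TB.
  rewrite /S /delta => /eqP; rewrite -subr_eq => /eqP <-.
  by apply/colP => j; rewrite !mxE; ring.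
rewrite (tT0 X Y sX sY); apply: (normalizer_torsion had (oU x) (Qsk x) n0 bS _ X12 T0E).
(* S is a difference of tensors commuting with Q, so its commutators with Q are 0. *)
move=> u J QJ; exists 0 => // v.
by rewrite /S cB// cA// mulmxBr subrr mul0mx.
Qed.
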